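(* Let $\varphi,\psi\colon[0,\infty)\to[0,\infty)$ be non-decreasing and let $\Gamma_1,\Gamma_2,\Lambda_1,\Lambda_2$ be finitely generated groups. If there is a $(\varphi,\psi)$-integrable orbit equivalence coupling from $\Gamma_1$ to $\Gamma_2$ and a $(\varphi,\psi)$-integrable orbit equivalence coupling from $\Lambda_1$ to $\Lambda_2$, then there is a $(\varphi,\psi)$-integrable orbit equivalence coupling from the wreath product $\Lambda_1\wr\Gamma_1$ to the wreath product $\Lambda_2\wr\Gamma_2$.
   Context: Wreath product: $\Lambda\wr\Gamma=\left(\bigoplus_{\Gamma}\Lambda\right)\rtimes\Gamma$, where $\bigoplus_\Gamma\Lambda$ is the group of finitely supported functions $\Gamma\to\Lambda$ and $\Gamma$ acts by $(\gamma\cdot f)(g)=f(\gamma^{-1}g)$. An orbit equivalence coupling from $\Gamma=\langle S_\Gamma\rangle$ to $\Lambda=\langle S_\Lambda\rangle$ ($S_\Gamma,S_\Lambda$ finite symmetric) is a standard probability space $(X,\mu)$ with free (up to null sets) measure-preserving actions of $\Gamma$ and $\Lambda$ such that $\Gamma\cdot x=\Lambda\cdot x$ for almost every $x\in X$. For $y\in\Lambda\cdot x$, $d_{S_\Lambda}(x,y)$ is the minimal word length of $\lambda\in\Lambda$ with $y=\lambda\cdot x$; $d_{S_\Gamma}$ is defined similarly. The coupling is $(\varphi,\psi)$-integrable if for all $\gamma\in\Gamma$ and $\lambda\in\Lambda$ there are $c_\gamma,c_\lambda>0$ such that $$\int_X\varphi\left(\frac{d_{S_\Lambda}(x,\gamma\cdot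 x)}{c_\gamma}\right)d\mu(x)<\infty\quad\text{and}\quad\int_X\psi\left(\frac{d_{S_\Gamma}(x,\lambda\cdot x)}{c_\lambda}\right)d\mu(x)<\infty.$$ *)

(* Defs.v *)
From HB Require Import structures.
From mathcomp Require Import all_boot all_order all_algebra finmap.
From mathcomp Require Import all_classical all_reals all_analysis.

Set Implicit Arguments.
Unset Strict Implicit.
Unset Printing Implicit Defensive.

Import Order.TTheory GRing.Theory Num.Theory.

Local Open Scope classical_set_scope.
Local Open Scope ring_scope.

Definition lamps (L G : groupType) := {fsfun G -> L with 1%g}.

Section Lamps.
Variables L G : groupType.
Implicit Types f : lamps L G.

Definition lamps1 : lamps L G := [fsfun with 1%g].

Definition lampsM f1 f2 : lamps L G :=
  [fsfun x in (finsupp f1 `|` finsupp f2)%fset => (f1 x * f2 x)%g].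

Definition lampsV f : lamps L G := [fsfun x in finsupp f => ((f x)^-1)%g].

Definition lamps_act (g : G) f : lamps L G :=
  [fsfun x in [fset (g * y)%g | y in finsupp f]%fset => f (g^-1 * x)%g].

Lemma lamps1E x : lamps1 x = 1%g.
Proof. by rewrite /lamps1 fsfunE. Qed.

Lemma lampsME f1 f2 x : lampsM f1 f2 x = (f1 x * f2 x)%g.
Proof.
rewrite /lampsM fsfunE inE.
by do 2![case: finsuppP => //= ?]; rewrite mulg1.
Qed.

Lemma lampsVE f x : lampsV f x = ((f x)^-1)%g.
Proof. by rewrite /lampsV fsfunE; case: finsuppP => //= _; rewrite invg1. Qed.

Lemma lamps_actE g f x : lamps_act g f x = f (g^-1 * x)%g.
Proof.
rewrite /lamps_act fsfunE; case: ifPn => // gx; rewrite fsfun_dflt//.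
apply: contra gx => fx; apply/imfsetP; exists (g^-1 * x)%g => //=.
by rewrite mulgA mulgV mul1g.
Qed.

End Lamps.

Definition wreath (L G : groupType) : Type := (lamps L G * G)%type.

HB.instance Definition _ (L G : groupType) := Choice.on (wreath L G).

Section Wreath.
Variables L G : groupType.
Implicit Types u v w : wreath L G.

Definition wreath1 : wreath L G := (lamps1 L G, 1%g).

Definition wreathM u v : wreath L G :=
  (lampsM u.1 (lamps_act u.2 v.1), (u.2 * v.2)%g).

Definition wreathV u : wreath L G :=
  (lamps_act (u.2^-1)%g (lampsV u.1), (u.2^-1)%g).

Let lampsE := (lampsME, lampsVE, lamps_actE, lamps1E).

Lemma wreathMA : associative wreathM.
Proof.
move=> u v w; congr pair => /=; last exact: mulgA.
by apply/fsfunP => x; rewrite !lampsE invgM !mulgA.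
Qed.

Lemma wreath1M : left_id wreath1 wreathM.
Proof.
move=> [f g]; congr pair => /=; last exact: mul1g.
by apply/fsfunP => x; rewrite !lampsE invg1 !mul1g.
Qed.

Lemma wreathM1 : right_id wreath1 wreathM.
Proof.
move=> [f g]; congr pair => /=; last exact: mulg1.
by apply/fsfunP => x; rewrite !lampsE mulg1.
Qed.

Lemma wreathVM : left_inverse wreath1 wreathV wreathM.
Proof.
move=> [f g]; congr pair => /=; last exact: mulVg.
by apply/fsfunP => x; rewrite !lampsE mulVg.
Qed.

Lemma wreathMV : right_inverse wreath1 wreathV wreathM.
Proof.
move=> [f g]; congr pair => /=; last exact: mulgV.
by apply/fsfunP => x; rewrite !lampsE invgK mulgA mulgV mul1g mulgV.
Qed.

HB.instance Definition _ := isGroup.Build (wreath L G)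
  wreathMA wreath1M wreathM1 wreathVM wreathMV.

End Wreath.

Definition is_word (G : groupType) (S : seq G) (g : G) (w : seq G) : Prop :=
  {subset w <= S} /\ (\prod_(s <- w) s)%g = g.

Definition symmetric_generating (G : groupType) (S : seq G) : Prop :=
  (forall s, s \in S -> (s^-1)%g \in S) /\ forall g, exists w, is_word S g w.

Definition finitely_generated (G : groupType) : Prop :=
  exists S : seq G, symmetric_generating S.

Definition lamp (L G : groupType) (x : G) (l : L) : lamps L G :=
  [fsfun y in [fset x]%fset => l].

Lemma lampE (L G : groupType) (x : G) (l : L) y :
  lamp x l y = if y == x then l else 1%g.
Proof. by rewrite /lamp fsfunE inE. Qed.

Lemma is_wordM (G : groupType) (S : seq G) g h :
  (exists w, is_word S g w) -> (exists w, is_word S h w) ->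
  exists w, is_word S (g * h)%g w.
Proof.
move=> [v [vS vg]] [w [wS wh]]; exists (v ++ w); split.
  by move=> x; rewrite mem_cat => /orP[/vS|/wS].
by rewrite big_cat /= vg wh.
Qed.

Lemma is_word_map (G H : groupType) (f : G -> H) (S : seq G) (T : seq H) g :
  f 1%g = 1%g -> (forall x y, f (x * y)%g = (f x * f y)%g) ->
  {subset map f S <= T} ->
  (exists w, is_word S g w) -> exists w, is_word T (f g) w.
Proof.
move=> f1 fM fST [w [wS <-]]; exists (map f w); split.
  by move=> _ /mapP[x xw ->]; apply/fST/map_f/wS.
rewrite big_map; elim: w {wS} => [|x w IH]; first by rewrite !big_nil.
by rewrite !big_cons IH fM.
Qed.

Lemma wreath_finitely_generated (L G : groupType) :
  finitely_generated L -> finitely_generated G ->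
  finitely_generated (wreath L G).
Proof.
move=> [SL [SLV SLg]] [SG [SGV SGg]].
pose iL x (l : L) : wreath L G := (lamp x l, 1%g).
pose iG (g : G) : wreath L G := (lamps1 L G, g).
have iL1 x : iL x 1%g = 1%g.
  by congr pair; apply/fsfunP => y; rewrite lampE lamps1E if_same.
have iLM x l m : iL x (l * m)%g = (iL x l * iL x m)%g.
  congr pair => /=; last by rewrite mul1g.
  apply/fsfunP => y; rewrite lampsME lamps_actE !lampE invg1 mul1g.
  by case: ifP; rewrite ?mul1g.
have iG1 : iG 1%g = 1%g by [].
have iGM g h : iG (g * h)%g = (iG g * iG h)%g.
  by congr pair; apply/fsfunP => y; rewrite lampsME lamps_actE !lamps1E mul1g.
have iLV l : (iL 1%g l)^-1%g = iL 1%g (l^-1)%g.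
  by apply/(mulgI (iL 1%g l)); rewrite mulgV -iLM mulgV iL1.
have iGV g : (iG g)^-1%g = iG (g^-1)%g.
  by apply/(mulgI (iG g)); rewrite mulgV -iGM mulgV iG1.
pose S := map (iL 1%g) SL ++ map iG SG; exists S; split.
  move=> s; rewrite !mem_cat => /orP[/mapP[l lS ->]|/mapP[g gS ->]].
    by rewrite iLV map_f ?SLV.
  by rewrite iGV (map_f iG) ?SGV ?orbT.
have genG g : exists w, is_word S (iG g) w.
  by apply: (is_word_map (S := SG)) => // x; rewrite mem_cat orbC => ->.
have genL x l : exists w, is_word S (iL x l) w.
  have -> : iL x l = (iG x * (iL 1%g l * iG x^-1))%g.
    congr pair => /=; last by rewrite mul1g mulgV.
    apply/fsfunP => y; rewrite !(lampsME, lamps_actE, lampE, lamps1E).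
    by rewrite mul1g mulg1 -[in RHS](inj_eq (mulgI x)) mulVKg mulg1.
  apply: is_wordM => //; apply: is_wordM => //.
  by apply: (is_word_map (S := SL)) => // y; rewrite mem_cat => ->.
have genf (s : seq G) (f : lamps L G) : {subset finsupp f <= s} ->
    exists w, is_word S ((f, 1%g) : wreath L G) w.
  elim: s f => [|x s IH] f fs.
    have -> : ((f, 1%g) : wreath L G) = iG 1%g.
      congr pair; apply/fsfunP => y; rewrite lamps1E fsfun_dflt//.
      by apply/negP => /fs.
    exact: genG.
  pose f' : lamps L G := [fsfun y in finsupp f => if y == x then 1%g else f y].
  have f'E y : f' y = if y == x then 1%g else f y.
    by rewrite /f' fsfunE; case: finsuppP => //; rewrite if_same.
  have -> : ((f, 1%g) : wreath L G) = (iL x (f x) * ((f', 1%g) : wreath L G))%g.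
    congr pair => /=; last by rewrite mul1g.
    apply/fsfunP => y; rewrite lampsME lamps_actE lampE f'E invg1 mul1g.
    by case: eqP => [->|_]; rewrite ?mulg1 ?mul1g.
  apply: is_wordM; first exact: genL.
  apply: IH => y; rewrite mem_finsupp f'E.
  case: (y =P x) => [_ /eqP|/eqP yx fy] //.
  have : y \in x :: s by apply: fs; rewrite mem_finsupp.
  by rewrite inE (negbTE yx).
move=> [f g].
have -> : ((f, g) : wreath L G) = (((f, 1%g) : wreath L G) * iG g)%g.
  congr pair => /=; last by rewrite mul1g.
  by apply/fsfunP => y; rewrite lampsME lamps_actE lamps1E mulg1.
by apply: is_wordM; [apply: (genf (finsupp f))|apply: genG].
Qed.

(* Equal to 0 when [A] is empty. *)
Definition least (A : set nat) : nat :=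
  get [set n | A n /\ forall m, A m -> (n <= m)%N].

Definition word_length (G : groupType) (S : seq G) (g : G) : nat :=
  least [set size w | w in is_word S g].

(* When [y] is not in the orbit of [x] the value is the junk value 0; for an
   orbit equivalence this only concerns a null set of points. *)
Definition orbit_dist (G : groupType) (X : Type) (a : G -> X -> X) (S : seq G)
    (x y : X) : nat :=
  least [set word_length S g | g in [set g | a g x = y]].

(* Isomorphic to the Borel space of a Polish space, i.e. of a separable space
   whose topology is induced by a complete metric. *)
Definition standard_borel (R : realType) (d : measure_display)
    (X : measurableType d) : Prop :=
  exists (P : completePseudoMetricType R) (f : X -> P),
    [/\ hausdorff_space P,
        exists2 D : set P, countable D & dense D,
        bijective f
      & forall A : set X, measurable A <-> <<s @open P >> (f @` A)].

Section Coupling.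
Variables (R : realType) (d : measure_display) (X : measurableType d).
Variable mu : probability X R.

Definition pmp_action (G : groupType) (a : G -> X -> X) : Prop :=
  [/\ forall x, a 1%g x = x,
      forall g h x, a (g * h)%g x = a g (a h x),
      forall g, measurable_fun setT (a g)
    & forall g A, measurable A -> mu (a g @^-1` A) = mu A].

Definition ae_free (G : groupType) (a : G -> X -> X) : Prop :=
  {ae mu, forall x, forall g, a g x = x -> g = 1%g}.

Definition same_orbits_ae (G H : groupType) (a : G -> X -> X)
    (b : H -> X -> X) : Prop :=
  {ae mu, forall x, range (a ^~ x) = range (b ^~ x)}.

Definition oe_coupling (G H : groupType) (a : G -> X -> X)
    (b : H -> X -> X) : Prop :=
  [/\ standard_borel R X, pmp_action a /\ pmp_action b,
      ae_free a /\ ae_free b & same_orbits_ae a b].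

(* The displacement of [a] measured in the word metric carried by the orbits
   of [b]. *)
Definition integrable_displacement (phi : R -> R) (G H : groupType)
    (a : G -> X -> X) (b : H -> X -> X) (T : seq H) : Prop :=
  forall g, exists2 c : R, 0 < c &
    (\int[mu]_x (phi ((orbit_dist b T x (a g x))%:R / c))%:E < +oo)%E.

End Coupling.

Definition has_integrable_oe_coupling (R : realType) (phi psi : R -> R)
    (G H : groupType) (S : seq G) (T : seq H) : Prop :=
  exists (d : measure_display) (X : measurableType d) (mu : probability X R)
      (a : G -> X -> X) (b : H -> X -> X),
    [/\ oe_coupling mu a b,
        integrable_displacement mu phi a b T
      & integrable_displacement mu psi b a S].

(* Main.v *)
Require Import Defs.
From HB Require Import structures.
From mathcomp Require Import all_boot all_order all_algebra finmap.
From mathcomp Require Import all_classical all_reals all_analysis.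
From mathcomp Require Import measurable_realfun lra.
Set Implicit Arguments.
Unset Strict Implicit.
Unset Printing Implicit Defensive.
Import Order.TTheory GRing.Theory Num.Theory.
Local Open Scope classical_set_scope.
Local Open Scope ring_scope.

(** Let [Gamma1] and [Gamma2] share their orbits on [X], and [Lambda1] and
    [Lambda2] theirs on [Y].  The wreath coupling lives on [X * Y^Gamma1] with
    the product measure.  [Lambda1 wr Gamma1] acts by
    [(f, g) (x, y) = (g x, k |-> f k . y (g^-1 k))].  The lamp at position [k]
    sits above the orbit point [k^-1 x]; as almost every orbit is also a free
    [Gamma2]-orbit, each [x] yields a bijection [Gamma1 -> Gamma2] between lamp
    positions.  Transporting along it the analogous action of
    [Lambda2 wr Gamma2] on [X * Y^Gamma2] gives a second action with the same
    orbits.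

    Elements with integrable displacement are closed under products, because
    [phi ((s + t) / (2 c)) <= phi (s / c) + phi (t / c)] for non-decreasing
    [phi] and the actions preserve the measure.  So only the base group and
    the lamps at the identity matter, and their displacements are bounded by
    multiples of those in the two given couplings. *)

(** * Countable powers of a probability space *)

(** Freeness and equality of orbits hold only almost everywhere, whereas an action must be defined
    and obey its laws at every point. The pointwise arguments therefore run on a measurable conull
    set invariant under the first action, and off it the bijection of lamp positions is copied from
    one fixed good point. The inverse in [k^-1 x] makes the bijection compatible with the base
    groups: the lamp at [k] over [g x] and the lamp at [g^-1 k] over [x] sit above the same orbit
    point. So when [g] in [Gamma1] and [h] in [Gamma2] move [x] to the same point, they also move
    the lamps in the same way, and the two actions differ only in the groups acting on the lamps.
    The bijection varies with [x], but in each fibre it merely renames the coordinates, so the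
    product measure is preserved. That it varies measurably, and that orbit distances are
    measurable, rests on one fact about standard Borel spaces: two measurable maps into such a space
    agree on a measurable set. *)

Definition coord_sets (I : Type) d (Y : measurableType d) :
  set (set (I -> Y)) :=
  [set A | exists i, exists2 B, measurable B & A = (fun y => y i) @^-1` B].

Notation power I Y := (g_sigma_algebraType (@coord_sets I _ Y)).

Lemma measurable_coord I d (Y : measurableType d) (i : I) :
  measurable_fun setT (fun y : power I Y => y i).
Proof.
by move=> _ B mB; rewrite setTI; apply: sub_sigma_algebra; exists i, B.
Qed.

Lemma measurable_fun_power I d (Y : measurableType d) d' (X : measurableType d')
    (f : X -> power I Y) :
  (forall i, measurable_fun setT (fun x => f x i)) -> measurable_fun setT f.
Proof.
move=> mf.
apply: (@measurability _ _ X (power I Y) setT f (@coord_sets I d Y)) => //.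
by move=> _ [_ [i [B mB ->]] <-]; apply: mf.
Qed.

Lemma countable_inj (K : Type) :
  countable [set: K] -> exists e : K -> nat, injective e.
Proof.
by move=> /Pcountable[T ->]; exists choice.pickle;
  apply: pcan_inj choice.pickleK.
Qed.

Lemma measurable_preimage d (X : measurableType d) d' (Z : measurableType d')
    (f : X -> Z) B :
  measurable_fun setT f -> measurable B -> measurable (f @^-1` B).
Proof. by move=> mf mB; rewrite -[X in measurable X]setTI; apply: mf. Qed.

Lemma measurable_fun_countable d (X : measurableType d)
    d' (Z : measurableType d') (K : Type) (f : X -> K) (g : K -> X -> Z) :
  countable [set: K] -> (forall k, measurable (f @^-1` [set k])) ->
  (forall k, measurable_fun setT (g k)) ->
  measurable_fun setT (fun x => g (f x) x).
Proof.
move=> cK mf mg _ B mB; rewrite setTI.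
rewrite (_ : _ @^-1` _ = \bigcup_k (f @^-1` [set k] `&` g k @^-1` B)).
  apply: countable_bigcupT_measurable => // k; apply: measurableI => //.
  exact: measurable_preimage.
by apply/seteqP; split=> x /=; [move=> Bx; exists (f x)|case=> k _ [<-]].
Qed.

Lemma countable_bigcapT_measurable d (X : measurableType d) (K : Type)
    (F : K -> set X) :
  countable [set: K] -> (forall k, measurable (F k)) ->
  measurable (\bigcap_k F k).
Proof.
move=> cK mF; rewrite -[X in measurable X]setCK setC_bigcap.
apply: measurableC; apply: countable_bigcupT_measurable => // k.
exact: measurableC.
Qed.

Lemma ae_countable d (X : measurableType d) (R : realType)
    (m : {measure set X -> \bar R}) (K : Type) (P : K -> X -> Prop) :
  countable [set: K] -> (forall k, {ae m, forall x, P k x}) ->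
  {ae m, forall x, forall k, P k x}.
Proof.
move=> /countable_inj[e einj] aeP.
have : {ae m, forall x, forall n, forall k, e k = n -> P k x}.
  apply: ae_foralln => n; have [[k <-]|nk] := pselect (exists k, e k = n).
    by apply: filterS (aeP k) => x Px k' /einj ->.
  by apply: nearW => x k kn; case: nk; exists k.
by apply: filterS => x Px k; apply: Px.
Qed.

Definition image_law (R : realType) d (X : measurableType d)
    d' (Z : measurableType d') (m : probability X R) (f : X -> Z)
    (mf : measurable_fun setT f) : probability Z R :=
  distribution m (HB.pack_for {mfun X >-> Z} f (isMeasurableFun.Build _ _ _ _
    f mf)).

(** * Extension theorem for the law of an independent sequence *)

Section Sequences.
Variables (R : realType) (d : measure_display) (Y : measurableType d).
Variable nu : probability Y R.
Notation S := (power nat Y).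
Local Open Scope ereal_scope.

Definition scons (z : Y * S) : S := fun n => if n is n'.+1 then z.2 n' else z.1.

Lemma measurable_scons : measurable_fun setT scons.
Proof.
apply: measurable_fun_power => -[|i]; first exact: measurable_fst.
exact: measurableT_comp (measurable_coord i) measurable_snd.
Qed.

(* Padding with the constant [point] keeps every finite product on the same
   space; on events depending on the first [n] coordinates the padding does not
   matter, which makes the family consistent. *)
Fixpoint fin_law (n : nat) : probability S R :=
  if n is n'.+1 then image_law (nu \x fin_law n') measurable_scons
  else \d_(point : S).

Definition slice (z : Y) (A : set S) : set S := [set y | A (scons (z, y))].

(** The product measure is by definition the integral of the masses of sections, so only sections
    and slices have to be identified. *)
Lemma fin_lawS n A : measurable A ->
  fin_law n.+1 A = \int[nu]_z fin_law n (slice z A).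
Proof.
move=> mA; rewrite [LHS]/(\int[nu]_z fin_law n (xsection (scons @^-1` A) z)).
apply: eq_integral => z _ /=; congr (fin_law n _).
by apply/seteqP; split=> y; rewrite /xsection /= inE.
Qed.

Lemma measurable_slice z A : measurable A -> measurable (slice z A).
Proof.
move=> mA.
apply: (@measurable_preimage _ S _ S (fun y => scons (z, y))) => //.
exact: measurableT_comp measurable_scons (pair1_measurable z).
Qed.

Lemma measurable_fin_law_slice n A : measurable A ->
  measurable_fun [set: Y] (fun z => fin_law n (slice z A)).
Proof.
move=> mA; pose A' : set (Y * S) := scons @^-1` A.
have mA' : measurable A' by exact: measurable_preimage measurable_scons mA.
have := measurable_fun_xsection (fin_law n) mA'.
congr measurable_fun; apply/funext => z /=; congr (fin_law n _).
by apply/seteqP; split=> y; rewrite /xsection /= inE.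
Qed.

Definition depends (n : nat) (A : set S) : Prop :=
  forall y y', (forall i, (i < n)%N -> y i = y' i) -> A y -> A y'.

Lemma dependsW m n A : (m <= n)%N -> depends m A -> depends n A.
Proof.
by move=> mn dA y y' yy'; apply: dA => i im; apply/yy'/leq_trans/mn.
Qed.

Lemma depends_slice n z A : depends n.+1 A -> depends n (slice z A).
Proof. by move=> dA y y' yy'; apply: dA => -[|i] //=; exact: yy'. Qed.

Lemma depends0 A : depends 0 A -> A = set0 \/ A = setT.
Proof.
move=> dA; have [->|/set0P[y Ay]] := eqVneq A set0; [by left|right].
by apply/seteqP; split=> // y' _; apply: dA Ay.
Qed.

(** Consistency of the family: the first coordinate is sliced off both laws until no coordinate
    matters, and then the event is empty or everything. *)
Lemma fin_law_depends n k A : measurable A -> depends n A -> (n <= k)%N ->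
  fin_law k A = fin_law n A.
Proof.
elim: n k A => [|n IH] [|k] A mA dA // nk.
  by have [->|->] := depends0 dA; rewrite ?measure0 ?probability_setT.
rewrite !fin_lawS //; apply: eq_integral => z _.
by apply: IH => //; [exact: measurable_slice|exact: depends_slice].
Qed.

Definition cylinder (A : set S) : Prop := measurable A /\ exists n, depends n A.

(** Some bound, not the least one; [cyl_lawE] shows that the law does not depend on the choice. *)
Definition depth (A : set S) : nat := get [set n | depends n A].

Definition cyl_law (A : set S) : \bar R := fin_law (depth A) A.

Lemma cyl_lawE n A : measurable A -> depends n A -> cyl_law A = fin_law n A.
Proof.
move=> mA dA; have dA' : depends (depth A) A
  by apply: (@getI _ [set n | depends n A] n).
by rewrite /cyl_law -(fin_law_depends mA dA (leq_maxl n (depth A)))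
  -(fin_law_depends mA dA' (leq_maxr n (depth A))).
Qed.

Lemma cyl_lawS n A : measurable A -> depends n A ->
  cyl_law A = \int[nu]_z cyl_law (slice z A).
Proof.
move=> mA dA; have dA' : depends n.+1 A by exact: dependsW dA.
rewrite (cyl_lawE mA dA') fin_lawS //; apply: eq_integral => z _.
by rewrite (@cyl_lawE n) //; [exact: measurable_slice|exact: depends_slice].
Qed.

Lemma measurable_cyl_law_slice A : cylinder A ->
  measurable_fun [set: Y] (fun z => cyl_law (slice z A)).
Proof.
move=> [mA [n dA]].
suff <- : (fun z => fin_law n (slice z A)) = (fun z => cyl_law (slice z A)).
  exact: measurable_fin_law_slice mA.
apply/funext => z; apply/esym/cyl_lawE; first exact: measurable_slice.
exact: depends_slice (dependsW (leqnSn n) dA).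
Qed.

Lemma cylinder_slice z A : cylinder A -> cylinder (slice z A).
Proof.
move=> [mA [n dA]]; split; first exact: measurable_slice.
by exists n; exact: depends_slice (dependsW (leqnSn n) dA).
Qed.

(* The threshold has to be lowered to [e / 2]: if no [z] had all its slices of
   mass at least [e / 2], the sets of those [z] whose [k]-th slice has mass at
   least [e / 2] would decrease to the empty set, hence have mass below
   [e / 2] for large [k]. *)
Lemma slice_mass_ge (A : (set S)^nat) (e : R) :
  (forall k, cylinder (A k)) ->
  (forall k, A k.+1 `<=` A k) -> (0 < e)%R ->
  (forall k, e%:E <= cyl_law (A k)) ->
  exists z, forall k, (e / 2)%:E <= cyl_law (slice z (A k)).
Proof.
move=> cA decA e0 leA.
pose g k z := cyl_law (slice z (A k)).
pose E k := [set z | (e / 2)%:E <= g k z].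
have mg k : measurable_fun [set: Y] (g k) by exact: measurable_cyl_law_slice.
have mE k : measurable (E k).
  rewrite (_ : E k = g k @^-1` `[(e / 2)%:E, +oo[%classic).
    by apply: measurable_preimage => //; exact: emeasurable_itv.
  by apply/seteqP; split=> z; rewrite /E/= in_itv/= andbT.
have [E0|/set0P[z Ez]] := eqVneq (\bigcap_k E k) set0; last first.
  by exists z => k; exact: Ez.
have ndE : {homo E : n m / (n <= m)%N >-> (m <= n)%O}.
  apply/nonincreasing_seqP => k; rewrite subsetEset => z; rewrite /E /g /=.
  move=> /le_trans; apply.
  have [mk [nk dk]] := cylinder_slice z (cA k).
  have [mk1 [nk1 dk1]] := cylinder_slice z (cA k.+1).
  rewrite (cyl_lawE mk1 (dependsW (leq_maxr nk nk1) dk1)).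
  rewrite (cyl_lawE mk (dependsW (leq_maxl nk nk1) dk)).
  by apply: le_measure; rewrite ?inE // => y; exact: decA.
have cvE : nu \o E @ \oo --> nu (\bigcap_k E k).
  apply: nonincreasing_cvg_mu => //.
  - by rewrite (le_lt_trans (probability_le1 _ _)) ?ltry.
  - by rewrite E0.
have g0 k z : 0 <= g k z by exact: measure_ge0.
have g1 k z : g k z <= 1.
  by apply: probability_le1; exact: measurable_slice (cA k).1.
(* The slice mass is at most 1 on [E k] and at most [e / 2] off it, so its integral is at most
   [nu (E k) + e / 2]. *)
have leE k : (e / 2)%:E <= nu (E k).
  rewrite -(@leeD2rE _ (e / 2)%:E) // -EFinD -splitr.
  apply: le_trans (leA k) _; have [mk [n dk]] := cA k.
  rewrite (cyl_lawS mk dk).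
  have -> : nu (E k) + (e / 2)%:E =
      \int[nu]_z ((\1_(E k) z)%:E + (e / 2)%:E).
    rewrite ge0_integralD //=.
    - by rewrite integral_indic // setIT integral_cst //
        [X in _ * X]probability_setT mule1.
    - exact/measurable_EFinP/measurable_indic.
    - by move=> _ _; rewrite lee_fin divr_ge0 // ltW.
  apply: ge0_le_integral => //=.
  - exact: mg.
  - by apply: emeasurable_funD => //; exact/measurable_EFinP/measurable_indic.
  move=> z _; rewrite indicE; have [zE|zE] := boolP (z \in E k).
    apply: le_trans (g1 k z) _; rewrite -EFinD lee_fin lerDl divr_ge0 //.
    exact: ltW.
  rewrite add0e; have := zE; rewrite notin_setE /E /= => /negP.
  by rewrite -ltNge => /ltW.
have : (e / 2)%:E <= limn (nu \o E).
  by apply: lime_ge; [exact: cvgP cvE|exact: nearW].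
rewrite (cvg_lim _ cvE) // E0 measure0 lee_fin leNgt.
by rewrite divr_gt0.
Qed.

(** The point [y] is built one coordinate at a time, each chosen by [slice_mass_ge] for the slices
    left by the previous ones. If [A k] depends on [n] coordinates, its [n]-th slice has positive
    mass, hence contains some tail [u], and that tail may be replaced by the tail of [y]. *)
Lemma cylinder_bigcap_nonempty (A : (set S)^nat) (e : R) :
  (forall k, cylinder (A k)) ->
  (forall k, A k.+1 `<=` A k) -> (0 < e)%R ->
  (forall k, e%:E <= cyl_law (A k)) -> \bigcap_k A k !=set0.
Proof.
move=> cA decA e0 leA.
(* The bound is existential because every slicing halves it. Below, [step] is vacuous off [good], so
   that [choice] gives a total function. *)
pose good (A : (set S)^nat) := [/\ forall k, cylinder (A k),
  forall k, A k.+1 `<=` A k &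
  exists2 e : R, (0 < e)%R & forall k, e%:E <= cyl_law (A k)].
have step (B : (set S)^nat) : exists z, good B -> good (fun k => slice z (B k)).
  have [[cB decB [r r0 leB]]|nB] := pselect (good B); last first.
    by exists point => /nB.
  have [z zP] := slice_mass_ge cB decB r0 leB; exists z => _; split.
  - by move=> k; exact: cylinder_slice.
  - by move=> k y; exact: decB.
  - by exists (r / 2)%R => //; rewrite divr_gt0.
have [f fP] := choice step.
pose B n := iter n (fun B : (set S)^nat => fun k => slice (f B) (B k)) A.
pose y : S := fun n => f (B n).
have gB n : good (B n).
  by elim: n => [|n IH]; [split=> //; exists e|exact: fP].
pose pre n (u : S) : S := fun i => if (i < n)%N then y i else u (i - n)%N.
have BE n k u : B n k u -> A k (pre n u).
  elim: n u => [|n IH] u Bu.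
    by rewrite (_ : pre 0%N u = u) //; apply/funext => i; rewrite /pre subn0.
  have -> : pre n.+1 u = pre n (scons (y n, u)); last by apply: IH; exact: Bu.
  apply/funext => i; rewrite /pre ltnS leq_eqVlt.
  have [->|ni] := eqVneq i n; first by rewrite ltnn subnn.
  case: ltnP => //= le_ni.
  have : (n < i)%N by rewrite ltn_neqAle eq_sym ni.
  by rewrite subnS -subn_gt0; case: (i - n)%N.
exists y => k _; have [mAk [n dAk]] := cA k.
have [cBn _ [r r0 leB]] := gB n.
have /set0P[u Bu] : B n k != set0.
  apply/eqP => B0; move: (leB k); rewrite B0 /cyl_law measure0 lee_fin.
  by rewrite leNgt r0.
by apply: dAk (BE n k u Bu) => i lt_in; rewrite /pre lt_in.
Qed.

(** A new display and an alias of [S]: the type [S] already carries the generated sigma-algebra,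
    while here the measurable sets must be the cylinders. *)
Definition cyl_display : measure_display. Proof. exact. Qed.
Definition cyl_space : Type := S.
HB.instance Definition _ := Pointed.on cyl_space.

Let cyl0 : cylinder set0.
Proof. by split=> //; exists 0%N. Qed.

Let cylU A B : cylinder A -> cylinder B -> cylinder (A `|` B).
Proof.
move=> [mA [m dA]] [mB [n dB]]; split; first exact: measurableU.
exists (maxn m n) => y y' yy'; case=> [Ay|By]; [left|right].
- exact: dependsW (leq_maxl m n) dA y y' yy' Ay.
- exact: dependsW (leq_maxr m n) dB y y' yy' By.
Qed.

Let cylC A : cylinder A -> cylinder (~` A).
Proof.
move=> [mA [n dA]]; split; first exact: measurableC.
by exists n => y y' yy' nAy Ay'; apply/nAy/dA/Ay' => i ni; rewrite yy'.
Qed.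

HB.instance Definition _ := @isAlgebraOfSets.Build cyl_display cyl_space
  cylinder cyl0 cylU cylC.

Lemma cyl_lawU A B : cylinder A -> cylinder B -> A `&` B = set0 ->
  cyl_law (A `|` B) = cyl_law A + cyl_law B.
Proof.
move=> cA cB AB0; have [mAB [k dAB]] := cylU cA cB.
move: cA cB => [mA [m dA]] [mB [n dB]].
pose N := maxn k (maxn m n).
rewrite (cyl_lawE mAB (dependsW (_ : (k <= N)%N) dAB)) ?leq_maxl //.
rewrite (cyl_lawE mA (dependsW (_ : (m <= N)%N) dA)); last first.
  by rewrite /N !leq_max leqnn !orbT.
rewrite (cyl_lawE mB (dependsW (_ : (n <= N)%N) dB)) ?measureU //.
by rewrite /N !leq_max leqnn !orbT.
Qed.

Let cyl_law0 : cyl_law set0 = 0. Proof. exact: measure0. Qed.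

Let cyl_law_ge0 (A : set cyl_space) : 0 <= cyl_law A.
Proof. exact: measure_ge0. Qed.

(** The tails [V n] of the union are cylinders, and finite additivity leaves exactly the mass of
    [V n] as error. If all tails had mass at least [e], they would share a point; it would lie in
    some [F k] and in [V k.+1], against disjointness. *)
Let cyl_law_semi_sigma_additive :
  semi_sigma_additive (cyl_law : set cyl_space -> \bar R).
Proof.
move=> F cF tF cU.
pose V n := \bigcup_(k in [set k | (n <= k)%N]) F k.
have VE n : V n = F n `|` V n.+1.
  apply/seteqP; split=> [y [k /= nk Fk]|y [Fn|[k /= nk Fk]]]; last 2 first.
  - by exists n => /=.
  - by exists k => //=; exact: ltnW.
  by move: nk; rewrite leq_eqVlt => /orP[/eqP->|nk]; [left|right; exists k].
have FV n : F n `&` V n.+1 = set0.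
  apply/seteqP; split=> // y [Fn [k /= nk Fk]].
  have := tF n k Logic.I Logic.I; case: (ltngtP n k) nk => // nk _ nkE.
  by move: nk; rewrite nkE ?ltnn //; exists y.
have V0 : V 0%N = \bigcup_k F k by apply/seteqP; split=> y [k]; exists k.
have cV n : cylinder (V n).
  elim: n => [|n IH]; first by rewrite V0.
  have -> : V n.+1 = V n `&` ~` F n.
    rewrite [V n]VE; apply/seteqP; split=> [y Vy|y [[]]//]; split;
      first by right.
    by move=> Fy; suff : (F n `&` V n.+1) y by rewrite FV.
  rewrite -(setCK (V n)) -setCU; apply: (cylC (cylU (cylC _) _)) => //.
  exact: cF.
have lawV n : cyl_law (\bigcup_k F k) =
    \sum_(0 <= i < n) cyl_law (F i) + cyl_law (V n).
  elim: n => [|n IH].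
    by rewrite big_geq // add0e V0.
  by rewrite IH [V n]VE (cyl_lawU (cF n) (cV n.+1) (FV n)) big_nat_recr //=
    addeA.
have cvs : cvgn (fun n => \sum_(0 <= i < n) cyl_law (F i)).
  exact: is_cvg_nneseries.
suff <- : limn (fun n => \sum_(0 <= i < n) cyl_law (F i)) =
  cyl_law (\bigcup_k F k) by [].
apply/eqP; rewrite eq_le; apply/andP; split.
  by apply: lime_le => //; apply: nearW => n; rewrite (lawV n) leeDl.
apply/lee_addgt0Pr => e e0.
have [n Vn] : exists n, cyl_law (V n) < e%:E.
  apply: contrapT => nV.
  have [y Vy] : \bigcap_k V k !=set0.
    apply: (cylinder_bigcap_nonempty cV _ e0) => k.
      by rewrite [V k]VE; exact: subsetUr.
    by rewrite leNgt; apply/negP => Vk; apply: nV; exists k.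
  have [k _ Fk] := Vy 0%N Logic.I.
  suff : (F k `&` V k.+1) y by rewrite FV.
  by split=> //; exact: Vy.
rewrite (lawV n); apply: leeD; last exact: ltW.
by apply: nneseries_lim_ge => k _ _; exact: cyl_law_ge0.
Qed.

HB.instance Definition _ := isMeasure.Build _ cyl_space R
  (cyl_law : set cyl_space -> \bar R) cyl_law0 cyl_law_ge0
    cyl_law_semi_sigma_additive.

(** Boxes are indexed through [c] so that pulling one back along a renaming of coordinates only
    composes [c] with the renaming. *)
Definition rect (I : Type) (K : eqType) (s : seq K) (c : K -> I)
    (A : K -> set Y) : set (power I Y) :=
  [set y | forall k, k \in s -> A k (y (c k))].

Lemma measurable_rect I (K : eqType) (s : seq K) (c : K -> I) A :
  (forall k, measurable (A k)) -> measurable (rect s c A).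
Proof.
move=> mA; elim: s => [|k s IH].
  by rewrite (_ : rect _ _ _ = setT) //; apply/seteqP; split.
rewrite (_ : rect _ _ _ = (fun y => y (c k)) @^-1` A k `&` rect s c A).
  apply: measurableI => //.
  by apply: measurable_preimage (mA k); exact: measurable_coord.
apply/seteqP; split=> y /=.
  move=> yA; split; first by apply: yA; rewrite inE eqxx.
  by move=> j js; apply: yA; rewrite inE js orbT.
by move=> [yk ys] j; rewrite inE => /orP[/eqP->|/ys].
Qed.

(** The keys split into [s0], sent to coordinate 0, and [s'], whose coordinates are shifted down by
    one for the induction. Uniqueness leaves at most one key in [s0]. *)
Lemma fin_law_rect n (K : eqType) (s : seq K) (c : K -> nat) A :
  (forall k, measurable (A k)) -> uniq (map c s) ->
  (forall k, k \in s -> (c k < n)%N) ->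
  fin_law n (rect s c A) = \prod_(k <- s) nu (A k).
Proof.
move=> mA; elim: n s c => [|n IH] s c us sn.
  case: s us sn => [_ _|k s _ /(_ k)]; last by rewrite inE eqxx => /(_ isT).
  rewrite big_nil (_ : rect _ _ _ = setT) ?probability_setT //.
  by apply/seteqP; split.
pose s0 := [seq k <- s | c k == 0%N]; pose s' := [seq k <- s | c k != 0%N].
pose c' k := (c k).-1.
pose E := [set z | forall k, k \in s0 -> A k z].
have -> : fin_law n.+1 (rect s c A) = (nu \x fin_law n)%E (E `*` rect s' c' A).
  rewrite [LHS]/((nu \x fin_law n)%E (scons @^-1` rect s c A)).
  suff -> : scons @^-1` rect s c A = E `*` rect s' c' A by [].
  apply/seteqP; split=> -[z y] /=.
    move=> yA; split=> k; rewrite mem_filter => /andP[ck /yA].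
      by rewrite (eqP ck).
    by rewrite /c'; case: (c k) ck.
  move=> [zE yA] k ks; have [ck|ck] := eqVneq (c k) 0%N.
    by rewrite ck; apply: zE; rewrite mem_filter ck eqxx.
  have := yA k; rewrite mem_filter ck ks /c' => /(_ isT).
  by case: (c k) ck.
have us0 : uniq (map c s0) by rewrite (subseq_uniq _ us) ?map_subseq
  ?filter_subseq.
have [mE nuE] : measurable E /\ nu E = \prod_(k <- s0) nu (A k).
  have : all (fun k => c k == 0%N) s0 by rewrite filter_all.
  rewrite /E; case: s0 us0 {E} => [_ _|k [|l t]] /=.
  - rewrite big_nil (_ : [set _ | _] = setT) ?probability_setT //.
    by apply/seteqP; split.
  - move=> _ _; rewrite big_seq1 (_ : [set _ | _] = A k) //.
    apply/seteqP; split=> z /=; first by apply; rewrite inE.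
    by move=> Az j; rewrite inE => /eqP->.
  - move=> u /andP[/eqP k0 /andP[/eqP l0 _]]; move: u.
    by rewrite k0 l0 inE eqxx.
have IHs : fin_law n (rect s' c' A) = \prod_(k <- s') nu (A k).
  apply: IH.
  - rewrite -(map_inj_uniq succn_inj) -map_comp.
    have -> : map (succn \o c') s' = map c s'.
      by apply/eq_in_map => k; rewrite mem_filter /c' /= => /andP[];
        case: (c k).
    by rewrite (subseq_uniq _ us) // map_subseq ?filter_subseq.
  - move=> k; rewrite mem_filter => /andP[k0 /sn].
    by rewrite /c'; case: (c k) k0.
rewrite product_measure1E //; last exact: measurable_rect.
rewrite [X in X * _ = _]nuE [X in _ * X = _]IHs.
by rewrite /s0 /s' !big_filter [RHS](bigID (fun k => c k == 0%N)).
Qed.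

Lemma fin_law_rect_cyl (K : eqType) (s : seq K) (c : K -> nat) A :
  (forall k, measurable (A k)) -> uniq (map c s) ->
  cylinder (rect s c A) /\ cyl_law (rect s c A) = \prod_(k <- s) nu (A k).
Proof.
(* A sum bounds each of its terms; the successor makes the bound strict. *)
move=> mA us; pose n := (\sum_(k <- s) c k).+1.
have sn k : k \in s -> (c k < n)%N.
  by move=> ks; rewrite ltnS (big_rem k) //= leq_addr.
have mr := @measurable_rect _ _ s c _ mA.
have dr : depends n (rect s c A).
  by move=> y y' yy' yA k ks; rewrite -yy' ?sn //; exact: yA.
split; first by split=> //; exists n.
by rewrite (cyl_lawE mr dr) fin_law_rect.
Qed.

Notation seq_space := (g_sigma_algebraType (@measurable _ cyl_space)).

Definition seq_law : set seq_space -> \bar R :=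
  measure_extension (cyl_law : {measure set cyl_space -> \bar R}).

HB.instance Definition _ := Measure.on seq_law.

Let seq_lawE A : cylinder A -> seq_law A = cyl_law A.
Proof.
exact: (@measurable_mu_extE _ _ _
  (cyl_law : {measure set cyl_space -> \bar R})).
Qed.

Let seq_lawT : seq_law setT = 1.
Proof.
have cT : cylinder setT by split=> //; exists 0%N.
by rewrite (seq_lawE cT); exact: probability_setT.
Qed.

HB.instance Definition _ := Measure_isProbability.Build _ _ _ seq_law seq_lawT.

Let restr I (e : I -> nat) (y : seq_space) : power I Y := y \o e.

Let measurable_restr I (e : I -> nat) : measurable_fun setT (restr e).
Proof.
apply: measurable_fun_power => i _ B mB; rewrite setTI.
apply: sub_sigma_algebra; split.
  by apply: measurable_preimage mB; exact: measurable_coord (e i).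
by exists (e i).+1 => y y' yy' /=; rewrite /restr /= yy'.
Qed.

Definition is_power_law (I : eqType) (m : probability (power I Y) R) : Prop :=
  forall (K : eqType) (s : seq K) (c : K -> I) (A : K -> set Y),
    (forall k, measurable (A k)) -> uniq (map c s) ->
    m (rect s c A) = \prod_(k <- s) nu (A k).

(** An independent sequence is read only at the coordinates [e i]; as [e] is injective, distinct
    indices read distinct coordinates. *)
Lemma power_law_exists (I : eqType) : countable [set: I] ->
  exists m : probability (power I Y) R, is_power_law m.
Proof.
move=> /countable_inj[e inj_e].
exists (image_law seq_law (measurable_restr e)) => K s c A mA us.
have [|cr <-] := @fin_law_rect_cyl K s (e \o c) A mA; last exact: seq_lawE.
by rewrite map_comp map_inj_uniq.
Qed.

(** Finite boxes generate the sigma-algebra and are stable under intersection. *)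
Lemma power_law_unique (I : eqType) (m m' : probability (power I Y) R) :
  is_power_law m -> is_power_law m' ->
  forall A, measurable A -> m A = m' A.
Proof.
move=> Pm Pm' A mA.
pose G : set (set (power I Y)) := [set B | exists s (C : I -> set Y),
  [/\ uniq s, forall i, measurable (C i) & B = rect s id C]].
have rect0 : rect [::] id (fun=> setT) = [set: power I Y].
  by apply/seteqP; split.
apply: (@measure_unique _ _ _ G (fun=> setT)) => //.
- apply/seteqP; split; apply: smallest_sub.
  + exact: smallest_sigma_algebra.
  + move=> _ [i [B mB ->]]; apply: sub_sigma_algebra.
    exists [:: i], (fun=> B); split=> //; apply/seteqP; split=> y /=.
      by move=> By k; rewrite inE => /eqP->.
    by apply; rewrite inE.
  + exact: sigma_algebra_measurable.
  + by move=> _ [s [C [_ mC ->]]]; exact: measurable_rect.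
- move=> _ _ [s [C [us mC ->]]] [t [D [ut mD ->]]].
  (* A key absent from one of the boxes is unconstrained there, hence the default [setT]. *)
  exists (undup (s ++ t)), (fun i => (if i \in s then C i else setT) `&`
    (if i \in t then D i else setT)); split; first exact: undup_uniq.
    by move=> i; apply: measurableI; case: ifP.
  apply/seteqP; split=> y /=.
    by move=> [yC yD] i _ /=; split; case: ifP => // ?; [exact: yC|exact: yD].
  move=> yCD; split=> i it; have := yCD i;
    rewrite mem_undup mem_cat it ?orbT /=.
    by move=> /(_ isT)[].
  by move=> /(_ isT)[].
- by move=> _; exists [::], (fun=> setT); split.
- by rewrite bigcup_const //; exists 0%N.
- move=> _ [s [C [us mC ->]]].
  have uid : uniq (map id s) by rewrite map_id.
  exact: etrans (Pm _ _ _ _ mC uid) (esym (Pm' _ _ _ _ mC uid)).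
- by move=> _; rewrite [X in X < _]probability_setT ltry.
Qed.

Lemma power_law_coord (I : eqType) (m : probability (power I Y) R) i B :
  is_power_law m -> measurable B -> m ((fun y => y i) @^-1` B) = nu B.
Proof.
move=> Pm mB; have := Pm I [:: i] id (fun=> B) (fun=> mB) isT.
rewrite big_seq1 => <-; congr (m _); apply/seteqP; split=> y /=.
  by move=> By k; rewrite inE => /eqP->.
by apply; rewrite inE.
Qed.

(** The preimage of a box is a box with factors of the same mass, and injectivity of [t] keeps its
    coordinates distinct, so uniqueness applies. This covers both the shift and switching of lamps
    and the change of index set. *)
Lemma power_law_map (I J : eqType) (m : probability (power I Y) R)
    (m' : probability (power J Y) R) (t : J -> I) (h : J -> Y -> Y) :
  is_power_law m -> is_power_law m' -> injective t ->
  (forall j, measurable_fun setT (h j)) ->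
  (forall j B, measurable B -> nu (h j @^-1` B) = nu B) ->
  forall A : set (power J Y), measurable A ->
    m ((fun (y : power I Y) j => h j (y (t j))) @^-1` A) = m' A.
Proof.
move=> Pm Pm' inj_t mh nuh A mA.
have mf : measurable_fun [set: power I Y]
    (fun y => (fun j => h j (y (t j))) : power J Y).
  apply: measurable_fun_power => j.
  exact: measurableT_comp (mh j) (measurable_coord (t j)).
suff P : is_power_law (image_law m mf) by exact: (power_law_unique P Pm').
move=> K s c C mC us.
have mhC k : measurable (h (c k) @^-1` C k) by exact: measurable_preimage.
have utc : uniq (map (t \o c) s) by rewrite map_comp map_inj_uniq.
apply: etrans (Pm _ _ _ _ mhC utc) _.
by apply: eq_bigr => k _; exact: nuh.
Qed.

End Sequences.

(** * Standard Borel products *)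

Lemma dense_seq (R : realType) (P : pseudoPMetricType R) (D : set P) :
  countable D -> dense D ->
  exists q : nat -> P, forall p (r : R), 0 < r -> exists n, ball p r (q n).
Proof.
move=> /countable_injP[e einj] dD.
exists (fun n => xget point [set x | D x /\ e x = n]) => p r r0.
have [||x [/interior_subset px Dx]] := dD (ball p r)°.
- by exists p; exact: nbhsx_ballx.
- exact: open_interior.
exists (e x); case: xgetP => [y _ [Dy eyx]|/(_ x)]; last by case.
by have <- : x = y by apply: einj; rewrite ?inE.
Qed.

(** * A complete separable metric structure on countable products *)

Section ProductMetric.
Variables (R : realType) (I : Type) (e : I -> nat).
Variable P : I -> completePseudoMetricType R.

(** The proof argument records [e] in the type, because the balls below depend on the
    enumeration. *)
Definition prod_space of injective e : Type := forall i, P i.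

Hypothesis inj_e : injective e.
Notation Q := (prod_space inj_e).

Definition weight (i : I) : R := (e i).+1%:R^-1.

Lemma weight_gt0 i : 0 < weight i. Proof. by rewrite invr_gt0. Qed.

(* The [i]-th coordinates are compared only when the radius is at most
   [weight i], so that a ball constrains finitely many coordinates. *)
Definition prod_ball (f : Q) (r : R) (g : Q) : Prop :=
  0 < r /\ forall i, r <= weight i -> ball (f i) r (g i).

Lemma prod_ball_center f (r : R) : 0 < r -> prod_ball f r f.
Proof. by move=> r0; split=> // i _; exact: ballxx. Qed.

Lemma prod_ball_sym f g (r : R) : prod_ball f r g -> prod_ball g r f.
Proof. by move=> [r0 fg]; split=> // i /fg /ball_sym. Qed.

(** Both radii are positive, so a coordinate compared at radius [r + s] is already compared at [r]
    and at [s]. *)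
Lemma prod_ball_triangle f g h (r s : R) :
  prod_ball f r g -> prod_ball g s h -> prod_ball f (r + s) h.
Proof.
move=> [r0 fg] [s0 gh]; split=> [|i rsi]; first exact: addr_gt0.
by apply: ball_triangle (fg i _) (gh i _); lra.
Qed.

HB.instance Definition _ := gen_eqMixin Q.
HB.instance Definition _ := gen_choiceMixin Q.
HB.instance Definition _ := isPointed.Build Q (fun=> point).
HB.instance Definition _ := hasNbhs.Build Q (nbhs_ (entourage_ prod_ball)).
HB.instance Definition _ := Nbhs_isPseudoMetric.Build R Q
  (erefl : nbhs = nbhs_ (entourage_ prod_ball))
  prod_ball_center prod_ball_sym prod_ball_triangle erefl.

Lemma nbhs_coord (f : Q) i (A : set (P i)) :
  nbhs (f i) A -> nbhs f ((fun g : Q => g i) @^-1` A).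
Proof.
move=> /nbhs_ballP[r /= r0 rA]; apply/nbhs_ballP.
exists (Num.min r (weight i)) => /=; first by rewrite lt_min r0 weight_gt0.
move=> g [_ fg]; apply: rA; apply: le_ball (fg i _);
  last by rewrite ge_min lexx orbT.
by rewrite ge_min lexx.
Qed.

(** Limits are taken coordinatewise. One pair [A], [B] of radius [r / 2] serves all coordinates: for
    each [i], an element [g] of [B], close to the limit at [i], links that limit to every [f] in
    [A]. *)
Lemma prod_space_complete (F : set_system Q) :
  ProperFilter F -> cauchy F -> cvg F.
Proof.
move=> PF /cauchy_ballP cF.
have cFi i : cvg ((fun g : Q => g i) @ F).
  apply: cauchy_cvg; apply/cauchy_ballP => r r0; rewrite near_map2.
  have m0 : 0 < Num.min r (weight i) by rewrite lt_min r0 weight_gt0.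
  apply: filterS (cF _ m0) => -[f g] [_ fg] /=.
  by apply: le_ball (fg i _); rewrite ge_min lexx ?orbT.
apply/cvg_ex; exists (fun i => lim ((fun g : Q => g i) @ F)).
apply/(@fcvg_ballP _ Q) => r r0.
have r20 : 0 < r / 2 by rewrite divr_gt0.
have [[A B] /= [FA FB] AB] := cF _ r20.
apply: filterS FA => f Af; split=> // i ri.
have [g [/= Bg lg]] : (B `&` [set g : Q |
    ball (lim ((fun g : Q => g i) @ F)) (r / 2) (g i)]) !=set0.
  apply: (@filter_ex _ F); apply: filterI => //.
  by apply: (@fcvg_ball R (P i) ((fun g : Q => g i) @ F) _ _ (cFi i) _ r20).
have [_ fg] := AB (f, g) (conj Af Bg).
rewrite [r]splitr; apply: ball_triangle lg _; apply/ball_sym/fg.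
by apply: le_trans ri; rewrite ler_pdivrMr // ler_peMr ?ltW //; lra.
Qed.

HB.instance Definition _ := Uniform_isComplete.Build Q prod_space_complete.

Lemma prod_space_hausdorff :
  (forall i, hausdorff_space (P i)) -> hausdorff_space Q.
Proof.
move=> hP f g fg; apply: functional_extensionality_dep => i.
apply: hP => A B fA gB.
have [h [Ah Bh]] := fg _ _ (nbhs_coord fA) (nbhs_coord gB).
by exists (h i).
Qed.

Lemma open_coord i (U : set (P i)) :
  open U -> open ((fun g : Q => g i) @^-1` U).
Proof.
by rewrite !openE => oU f /= Ufi; apply: nbhs_coord; exact: oU.
Qed.

Section Separable.
Variable q : forall i, nat -> P i.
Hypothesis dense_q :
  forall i p (r : R), 0 < r -> exists n, ball p r (q i n).

(** Beyond the end of the list the default index 0 is used, so finite lists name countably many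
    points. *)
Definition seq_point (s : seq nat) : Q := fun i => q i (nth 0%N s (e i)).

(** The condition [r <= weight i] means [e i + 1 <= 1 / r], so a list of length just above [1 / r]
    reaches every relevant coordinate. Here [r] selects the coordinates and [r'] is the accuracy. *)
Lemma seq_point_approx (f : Q) (r r' : R) : 0 < r -> 0 < r' ->
  exists s, forall i, r <= weight i -> ball (f i) r' (seq_point s i).
Proof.
move=> r0 r'0.
have [k kP] := choice (fun i => dense_q (f i) r'0).
have /choice[k' k'P] : forall n, exists m, forall i, e i = n -> m = k i.
  move=> n; have [[i <-]|nn] := pselect (exists i, e i = n).
    by exists (k i) => j /inj_e ->.
  by exists 0%N => i ein; case: nn; exists i.
exists (mkseq k' (Num.truncn r^-1).+1) => i ri.
rewrite /seq_point nth_mkseq; first by rewrite (k'P _ i).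
apply: leqW; rewrite truncn_gt_nat.
by rewrite -[X in X <= _]invrK lef_pV2 ?posrE ?invr_gt0 // ltr0n.
Qed.

Lemma dense_seq_point : dense (range seq_point).
Proof.
move=> O [f Of] oO.
have : nbhs f O by apply: open_nbhs_nbhs; split.
move=> /nbhs_ballP[r /= r0 rO].
have [s fs] := @seq_point_approx f r r r0 r0.
by exists (seq_point s); split; [apply: rO|exists s].
Qed.

Lemma prod_space_separable : exists2 D : set Q, countable D & dense D.
Proof.
exists (range seq_point); last exact: dense_seq_point.
exact: sub_countable (card_image_le _ _) (countableP _).
Qed.

Definition coord_opens : set (set Q) :=
  [set A | exists i, exists2 U : set (P i), open U & A = (fun g =>
    g i) @^-1` U].

(** By separability an open set is the union of the countably many boxes around named points that it
    contains, and each box is a countable intersection of coordinate conditions. *)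
Lemma sigma_open_prod_space : <<s (@open Q) >> = <<s coord_opens>>.
Proof.
apply/seteqP; split; last first.
  apply: smallest_sub => [|_ [i [U oU ->]]];
    first exact: smallest_sigma_algebra.
  by apply: sub_sigma_algebra; exact: open_coord.
apply: smallest_sub; first exact: smallest_sigma_algebra.
move=> U oU.
pose T := g_sigma_algebraType coord_opens.
pose rad (n : nat) : R := n.+1%:R^-1.
have rad_gt0 n : 0 < rad n by rewrite invr_gt0.
(* Interiors are taken because balls of a pseudometric structure need not be open. *)
pose box (sn : seq nat * nat) : set Q := [set g | forall i,
  rad sn.2 <= weight i -> (ball (seq_point sn.1 i) (rad sn.2))° (g i)].
have cI : countable [set: I].
  by apply/countable_injP; exists e => i j _ _; exact: inj_e.
have mbox sn : measurable (box sn : set T).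
  rewrite (_ : box sn = \bigcap_i [set g : T | rad sn.2 <= weight i ->
      (ball (seq_point sn.1 i) (rad sn.2))° (g i)]); last first.
    by apply/seteqP; split=> g gb i => [_|]; exact: gb.
  apply: countable_bigcapT_measurable => // i.
  have [le_i|lt_i] := boolP (rad sn.2 <= weight i).
    apply: sub_sigma_algebra; exists i.
    exists (ball (seq_point sn.1 i) (rad sn.2))°; first exact: open_interior.
    by apply/seteqP; split=> g /=; [apply|].
  by rewrite (_ : [set _ | _] = setT) //; exact/seteqP.
rewrite (_ : U = \bigcup_sn (if pselect (box sn `<=` U) then box sn else set0)).
  apply: (@countable_bigcupT_measurable _ T) => // sn.
  by case: pselect => [?|?] /=; [exact: mbox|exact: measurable0].
apply/seteqP; split=> [g Ug|g [sn _]]; last by case: pselect => [bU /bU|].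
have : nbhs g U by apply: open_nbhs_nbhs; split.
move=> /nbhs_ballP[r /= r0 rU].
(* With a named point within [rad n / 2] of [g], every point of its box is within
   [rad n / 2 + rad n < r] of [g]. *)
have [n nr] : exists n, rad n < r / 2.
  exists (Num.truncn (r / 2)^-1).
  rewrite /rad invf_plt ?posrE ?divr_gt0 //.
  by have := truncnS_gt (r / 2)^-1.
have rn20 : 0 < rad n / 2 by rewrite divr_gt0.
have [s gs] := @seq_point_approx g (rad n) _ (rad_gt0 n) rn20.
exists (s, n) => //; case: pselect => [?|[]] /=.
  move=> i /gs gsi; apply/nbhs_ballP; exists (rad n / 2) => // h gh.
  by rewrite [rad n]splitr; apply: ball_triangle gh; exact: ball_sym.
move=> h bh; apply: rU; split=> // i ri.
have rni : rad n <= weight i by apply: le_trans ri; lra.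
apply: (@le_ball _ _ _ (rad n / 2 + rad n)); first by lra.
by apply: ball_triangle (gs i rni) _; exact: interior_subset (bh i rni).
Qed.

End Separable.
End ProductMetric.

(** * Standard Borel spaces through Polish models *)

Section StandardBorel.
Variable R : realType.

Lemma countable_option (T : Type) :
  countable [set: T] -> countable [set: option T].
Proof.
move=> /countable_inj[e inj_e]; apply/countable_injP.
exists (fun x => if x is Some y then (e y).+1 else 0%N).
by case=> [x|] [y|] _ _ //= [/inj_e ->].
Qed.

(* A Polish model of a standard Borel space, with the equality of
   sigma-algebras split into measurability of [f] and of its inverse. *)
Lemma standard_borel_model d (X : measurableType d) : standard_borel R X ->
  exists (P : completePseudoMetricType R) (q : nat -> P) (f : X -> P),
    [/\ hausdorff_space P,
        forall p (r : R), 0 < r -> exists n, ball p r (q n),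
        bijective f,
        measurable_fun setT (f : X -> g_sigma_algebraType (@open P))
      & forall d' (T : measurableType d') (h : T -> X),
          (forall U, open U -> measurable ((f \o h) @^-1` U)) ->
          measurable_fun setT h].
Proof.
move=> [P [f [hP [D cD dD] bf mf]]].
have [q qP] := dense_seq cD dD.
exists P, q, f; split=> //.
  move=> _ B mB; rewrite setTI; apply/mf.
  by have [g fK gK] := bf; rewrite image_preimage //; apply/seteqP;
    split=> // p _; exists (g p).
move=> d' T h mh _ A /mf mA; rewrite setTI.
have mfh : measurable_fun setT (f \o h : T -> g_sigma_algebraType (@open P)).
  apply: (@measurability _ _ _ (g_sigma_algebraType (@open P)) _ _ (@open P))
    => //.
  by move=> _ [U oU <-]; rewrite setTI; exact: mh.
rewrite (_ : h @^-1` A = (f \o h) @^-1` (f @` A)).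
  exact: (@measurable_preimage _ _ _ (g_sigma_algebraType (@open P))).
apply/seteqP; split=> t /=; first by exists (h t).
by move=> [x Ax /(bij_inj bf) <-].
Qed.

(** If the image of [y] lies in every basic ball around the image of [x], the two images are
    arbitrarily close, hence equal in a Hausdorff space. *)
Lemma standard_borel_separating d (X : measurableType d) : standard_borel R X ->
  exists E : nat * nat -> set X, (forall n, measurable (E n)) /\
    forall x y, (forall n, E n x -> E n y) -> x = y.
Proof.
move=> /standard_borel_model[P [q [f [hP qP bf mf _]]]].
pose rad (n : nat) : R := n.+1%:R^-1.
exists (fun n => f @^-1` (ball (q n.1) (rad n.2))°); split.
  move=> n; apply: (@measurable_preimage _ _ _ (g_sigma_algebraType (@open
    P))) => //.
  by apply: sub_sigma_algebra; exact: open_interior.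
move=> x y xy; apply: (bij_inj bf); apply: (close_eq hP);
  rewrite ball_close => r.
have [m mr] : exists m, rad m < r%:num / 2.
  exists (Num.truncn (r%:num / 2)^-1).
  by rewrite /rad invf_plt ?posrE ?divr_gt0 // truncnS_gt.
have m0 : 0 < rad m / 2 by rewrite divr_gt0 // invr_gt0.
have [n xn] := qP (f x) _ m0.
have /interior_subset yn : (ball (q n) (rad m))° (f y).
  apply: (xy (n, m)); apply/nbhs_ballP; exists (rad m / 2) => // p xp.
  by rewrite [rad m]splitr; apply: ball_triangle xp; exact: ball_sym.
apply: (@le_ball _ _ _ (rad m / 2 + rad m)); first by lra.
exact: ball_triangle xn yn.
Qed.

Lemma measurable_eq_fun d (X : measurableType d) d' (T : measurableType d')
    (u v : T -> X) : standard_borel R X ->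
  measurable_fun setT u -> measurable_fun setT v ->
  measurable [set t | u t = v t].
Proof.
move=> /standard_borel_separating[E [mE sepE]] mu mv.
rewrite (_ : [set _ | _] = \bigcap_n (~` (u @^-1` E n) `|` v @^-1` E n)).
  apply: countable_bigcapT_measurable => // n; apply: measurableU.
    by apply: measurableC; exact: measurable_preimage.
  exact: measurable_preimage.
apply/seteqP; split=> t /=; last first.
  move=> uvE; apply: sepE => n un; have [] := uvE n Logic.I; last by [].
  by move=> /(_ un).
by move=> uv n _ /=; rewrite uv; have [] := pselect (E n (v t)); [right|left].
Qed.

(** The factor [X] becomes the coordinate [None] of one product over [option I]. Since coordinate
    opens generate the Borel sets, it suffices that [h] and its inverse are measurable. *)
Lemma standard_borel_power d (X : measurableType d) d' (Y : measurableType d')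
    (I : Type) : countable [set: I] -> standard_borel R X ->
  standard_borel R Y -> standard_borel R (X * power I Y)%type.
Proof.
move=> cI /standard_borel_model[PX [qX [f [hX qXP [f' fK f'K] mf mX]]]].
move=> /standard_borel_model[PY [qY [g [hY qYP [g' gK g'K] mg mY]]]].
have [e inj_e] := countable_inj (countable_option cI).
pose P (o : option I) := if o is Some _ then PY else PX.
pose q o : nat -> P o := if o is Some _ then qY else qX.
have qP o p (r : R) : 0 < r -> exists n, ball p r (q o n).
  by case: o p => [i|] p; [exact: qYP|exact: qXP].
pose h (z : X * power I Y) : prod_space P inj_e :=
  fun o => if o is Some i then g (z.2 i) else f z.1.
pose h' (p : prod_space P inj_e) : X * power I Y :=
  (f' (p None), fun i => g' (p (Some i))).
have hK : cancel h h'.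
  by move=> [x y]; rewrite /h' /h /= fK; congr pair; apply/funext => i;
    exact: gK.
have h'K : cancel h' h.
  move=> p; apply: functional_extensionality_dep => -[i|]; first exact: g'K.
  exact: f'K.
exists (prod_space P inj_e), h; split.
- by apply: prod_space_hausdorff; case.
- exact: prod_space_separable qP.
- by exists h'.
pose B := g_sigma_algebraType (@coord_opens R _ e P inj_e).
have mh : measurable_fun setT (h : X * power I Y -> B).
  apply: (@measurability _ _ _ B _ _ (@coord_opens R _ e P inj_e)) => //.
  move=> _ [_ [j [U oU ->]] <-]; rewrite setTI.
  case: j U oU => [i|] U oU.
    apply: (@measurable_preimage _ _ _ (g_sigma_algebraType (@open PY))
      (fun z : X * power I Y => g (z.2 i))); last exact: sub_sigma_algebra.
    apply: measurableT_comp mg _.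
    exact: measurableT_comp (measurable_coord i) measurable_snd.
  apply: (@measurable_preimage _ _ _ (g_sigma_algebraType (@open PX))
    (fun z : X * power I Y => f z.1)); last exact: sub_sigma_algebra.
  exact: measurableT_comp mf measurable_fst.
have mh' : measurable_fun setT (h' : B -> X * power I Y).
  apply: measurable_fun_pair.
    apply: (mX _ B) => U oU; apply: sub_sigma_algebra; exists None, U => //.
    by apply/seteqP; split=> p /=; rewrite f'K.
  apply: measurable_fun_power => i.
  apply: (mY _ B) => U oU; apply: sub_sigma_algebra; exists (Some i), U => //.
  by apply/seteqP; split=> p /=; rewrite g'K.
have imE (A : set (X * power I Y)) : h @` A = h' @^-1` A.
  apply/seteqP; split=> [_ [z Az <-]|p Ap] /=; first by rewrite hK.
  by exists (h' p).
move=> A; rewrite (@sigma_open_prod_space R _ e P inj_e q qP) imE; split=> mA.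
  exact: (@measurable_preimage _ B).
rewrite (_ : A = h @^-1` (h' @^-1` A)).
  exact: (@measurable_preimage _ _ _ B).
by apply/seteqP; split=> z /=; rewrite hK.
Qed.

End StandardBorel.

(** * Measure preserving actions of wreath products *)

Definition measure_preserving (R : realType) d (X : measurableType d)
    d' (Z : measurableType d') (m : probability X R) (m' : probability Z R)
    (f : X -> Z) : Prop :=
  measurable_fun setT f /\
  forall A, measurable A -> m (f @^-1` A) = m' A.

Section MeasurePreserving.
Variable R : realType.
Context d1 (X : measurableType d1) d2 (Z : measurableType d2).
Context d3 (V : measurableType d3) d4 (W : measurableType d4).
Variables (mX : probability X R) (mZ : probability Z R).
Variables (mV : probability V R) (mW : probability W R).

Lemma measure_preserving_comp (f : X -> Z) (g : Z -> V) :
  measure_preserving mX mZ f -> measure_preserving mZ mV g ->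
  measure_preserving mX mV (g \o f).
Proof.
move=> [mf Pf] [mg Pg]; split; first exact: measurableT_comp mg mf.
by move=> A mA; rewrite comp_preimage Pf ?Pg //; exact: measurable_preimage.
Qed.

Lemma ae_preserving (f : X -> Z) (P : Z -> Prop) :
  measure_preserving mX mZ f -> {ae mZ, forall z, P z} ->
  {ae mX, forall x, P (f x)}.
Proof.
move=> [mf Pf] [N [mN N0 PN]]; exists (f @^-1` N); split.
- exact: measurable_preimage.
- by rewrite Pf.
- by move=> x /= nPx; apply: PN.
Qed.

Lemma ge0_integral_preserving (f : X -> Z) (h : Z -> \bar R) :
  measure_preserving mX mZ f -> measurable_fun setT h ->
  (forall z, (0 <= h z)%E) ->
  (\int[mX]_x h (f x) = \int[mZ]_z h z)%E.
Proof.
move=> [mf Pf] mh h0.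
have := ge0_integral_pushforward mf mX measurableT mh (fun z _ => h0 z).
rewrite preimage_setT => <-.
by apply: eq_measure_integral => A mA _; exact: Pf.
Qed.

Lemma fst_preserving : measure_preserving (mX \x mW)%E mX fst.
Proof.
split=> [|A mA]; first exact: measurable_fst.
have := product_measure1E mX mW mA measurableT.
rewrite [X in (_ * X)%E]probability_setT mule1 => <-.
by congr (_ _); apply/seteqP; split=> z //= [].
Qed.

Lemma snd_preserving : measure_preserving (mX \x mW)%E mW snd.
Proof.
split=> [|A mA]; first exact: measurable_snd.
have := product_measure1E mX mW measurableT mA.
rewrite [X in (X * _)%E]probability_setT mul1e => <-.
by congr (_ _); apply/seteqP; split=> z //= [].
Qed.

(** Integrate over sections: the section of the preimage at [x] is the preimage under [g x] of the
    section at [f x]. *)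
Lemma skew_product_preserving (f : X -> Z) (g : X -> V -> W) :
  measurable_fun setT (fun z : X * V => (f z.1, g z.1 z.2)) ->
  measure_preserving mX mZ f ->
  (forall x B, measurable B -> mV (g x @^-1` B) = mW B) ->
  measure_preserving (mX \x mV)%E (mZ \x mW)%E
    (fun z : X * V => (f z.1, g z.1 z.2)).
Proof.
move=> mfg Pf Pg; split=> // A mA.
have mfA := measurable_fun_xsection mW mA.
have intE := ge0_integral_preserving Pf mfA (fun z => measure_ge0 _ _).
transitivity (\int[mX]_x mW (xsection A (f x)))%E; last exact: intE.
apply: eq_integral => x _ /=.
rewrite -(Pg x) /=; last exact: measurable_xsection.
congr (mV _); apply/seteqP; split=> v;
  by rewrite /xsection /= !inE.
Qed.

End MeasurePreserving.

Section WreathAction.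
Variables (R : realType) (G L : groupType).
Context d1 (X : measurableType d1) d2 (Y : measurableType d2).
Variables (mu : probability X R) (nu : probability Y R).
Variables (a : G -> X -> X) (b : L -> Y -> Y).
Variable m : probability (power G Y) R.

Definition wreath_action (u : wreath L G) (z : X * power G Y) :
    X * power G Y :=
  (a u.2 z.1, fun h => b (u.1 h) (z.2 (u.2^-1 * h)%g)).

Hypotheses (pa : pmp_action mu a) (pb : pmp_action nu b).
Hypothesis Pm : is_power_law nu m.

Lemma wreath_action_pmp : pmp_action (mu \x m)%E wreath_action.
Proof.
have [a1 aM ma Pa] := pa; have [b1 bM mb Pb] := pb.
have mw u : measurable_fun setT (wreath_action u).
  apply: measurable_fun_pair;
    first exact: measurableT_comp (ma _) measurable_fst.
  apply: measurable_fun_power => h; apply: measurableT_comp (mb _) _.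
  exact: measurableT_comp (measurable_coord _) measurable_snd.
split=> [[x y]|u v [x y]|u|u A mA]; last 1 first.
- have Pu : measure_preserving (mu \x m)%E (mu \x m)%E (wreath_action u).
    apply: (@skew_product_preserving R _ X _ X _ (power G Y) _ (power G Y) mu
      mu m m
      (a u.2) (fun _ y h => b (u.1 h) (y (u.2^-1 * h)%g))) => //.
    - exact: mw.
    - by split; [exact: ma|exact: Pa].
    - move=> _ B mB.
      apply: (@power_law_map R _ Y nu G G m m (fun h => (u.2^-1 * h)%g)
        (fun h => b (u.1 h))) => //.
      + exact: mulgI.
      + by move=> h C mC; exact: Pb.
  exact: Pu.2.
- congr pair; first exact: a1.
  by apply/funext => h /=; rewrite lamps1E b1 invg1 mul1g.
- congr pair; first exact: aM.
  by apply/funext => h /=; rewrite lampsME lamps_actE bM invgM mulgA.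
- exact: mw.
Qed.

End WreathAction.

Definition relabel (I J : Type) d1 (X : measurableType d1)
    d2 (Y : measurableType d2) (s : X -> J -> I) (z : X * power I Y) :
    X * power J Y :=
  (z.1, fun j => z.2 (s z.1 j)).

Section Reindexing.
Variables (R : realType) (I J : eqType).
Context d1 (X : measurableType d1) d2 (Y : measurableType d2).
Variables (mu : probability X R) (nu : probability Y R).
Variables (mI : probability (power I Y) R) (mJ : probability (power J Y) R).
Hypotheses (PI : is_power_law nu mI) (PJ : is_power_law nu mJ).

(** For fixed [x] this renames coordinates injectively, which preserves the power law. Joint
    measurability holds because the coordinate read takes countably many values, each on a
    measurable set. *)
Lemma relabel_preserving (s : X -> J -> I) : countable [set: I] ->
  (forall x, injective (s x)) ->
  (forall j i, measurable [set x | s x j = i]) ->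
  measure_preserving (mu \x mI)%E (mu \x mJ)%E (relabel s).
Proof.
move=> cI inj_s ms.
apply: (@skew_product_preserving R _ X _ X _ (power I Y) _ (power J Y) mu mu
  mI mJ id (fun x y j => y (s x j))).
- apply: measurable_fun_pair; first exact: measurable_fst.
  apply: measurable_fun_power => j.
  apply: (@measurable_fun_countable _ _ _ _ I (fun z : X * power I Y => s z.1 j)
    (fun i z => z.2 i)) => // i.
    exact: measurable_preimage measurable_fst (ms j i).
  exact: measurableT_comp (measurable_coord i) measurable_snd.
- by split.
- move=> x B mB.
  exact: (@power_law_map R _ Y nu I J mI mJ (s x) (fun=> id)).
Qed.

End Reindexing.

Lemma pmp_action_conj (R : realType) (G : groupType)
    d1 (X : measurableType d1) d2 (Z : measurableType d2)
    (mX : probability X R) (mZ : probability Z R)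
    (a : G -> Z -> Z) (f : X -> Z) (f' : Z -> X) :
  cancel f f' -> cancel f' f ->
  measure_preserving mX mZ f -> measure_preserving mZ mX f' ->
  pmp_action mZ a -> pmp_action mX (fun g x => f' (a g (f x))).
Proof.
move=> fK f'K Pf Pf' [a1 aM ma Pa].
have Pag g : measure_preserving mX mX (f' \o (a g \o f)).
  apply: measure_preserving_comp Pf'.
  by apply: measure_preserving_comp Pf _; split; [exact: ma|exact: Pa].
split=> [x|g h x|g|g A mA].
- by rewrite a1 fK.
- by rewrite f'K aM.
- exact: (Pag g).1.
- exact: (Pag g).2.
Qed.

(** * Word lengths and generators of wreath products *)

Lemma leastP (A : set nat) : A !=set0 ->
  A (least A) /\ forall m, A m -> (least A <= m)%N.
Proof.
move=> A0; pose M := [set n | A n /\ forall m, A m -> (n <= m)%N].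
suff [n Mn] : M !=set0 by exact: (@getI _ M n).
have exA : exists n, `[< A n >] by have [n An] := A0; exists n; exact/asboolP.
exists (ex_minn exA); case: ex_minnP => n /asboolP An nmin; split=> // m Am.
exact/nmin/asboolP.
Qed.

Lemma least_set0 : least set0 = 0%N.
Proof. by rewrite /least; case: xgetP => // n _ []. Qed.

Section WordLength.
Variables (G : groupType) (S : seq G).
Hypothesis genS : symmetric_generating S.

Lemma word_length_le g w : is_word S g w -> (word_length S g <= size w)%N.
Proof.
move=> gw; have [|_ le_g] := @leastP [set size w | w in is_word S g].
  by exists (size w), w.
by apply: le_g; exists w.
Qed.

Lemma word_length_word g : exists2 w, is_word S g w & size w = word_length S g.
Proof.
have [w gw] := genS.2 g; have [|[v gv sv] _] :=
  @leastP [set size w | w in is_word S g].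
  by exists (size w); exists w.
by exists v.
Qed.

Lemma word_lengthM g h :
  (word_length S (g * h)%g <= word_length S g + word_length S h)%N.
Proof.
have [v [vS vg] <-] := word_length_word g; have [w [wS wh] <-] :=
  word_length_word h.
rewrite -size_cat; apply: word_length_le; split;
  last by rewrite big_cat /= vg wh.
by move=> s; rewrite mem_cat => /orP[/vS|/wS].
Qed.

Lemma word_length1 : word_length S 1%g = 0%N.
Proof.
by apply/eqP; rewrite -leqn0; apply: (@word_length_le _ [::]); split;
  rewrite ?big_nil.
Qed.

Lemma countable_generated : countable [set: G].
Proof.
pose f (w : seq nat) : G := (\prod_(i <- w) nth 1 S i)%g.
apply: (@sub_countable _ _ _ [set: seq nat]); last exact: countableP.
apply: (@card_le_trans _ _ _ (range f)); last exact: card_image_le.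
apply: subset_card_le => g _; have [w [wS <-]] := genS.2 g.
exists (map (index^~ S) w) => //.
by rewrite /f big_map; apply: eq_big_seq => s /wS sS; rewrite nth_index.
Qed.

Section OrbitDist.
Variables (X : Type) (a : G -> X -> X).

Lemma orbit_dist_le x y g :
  a g x = y -> (orbit_dist a S x y <= word_length S g)%N.
Proof.
move=> gxy; have [|_ le_g] := @leastP [set word_length S g | g in [set g | a g
  x = y]].
  by exists (word_length S g), g.
by apply: le_g; exists g.
Qed.

Lemma orbit_dist_ex x y : (exists g, a g x = y) ->
  exists2 g, a g x = y & word_length S g = orbit_dist a S x y.
Proof.
move=> [g gxy].
have [|[h hxy sh] _] := @leastP [set word_length S g | g in [set g | a g x =
  y]].
  by exists (word_length S g), g.
by exists h.
Qed.

Lemma orbit_dist_triangle x y z :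
  (forall g h x, a (g * h)%g x = a g (a h x)) ->
  (exists g, a g x = y) -> (exists g, a g y = z) ->
  (orbit_dist a S x z <= orbit_dist a S x y + orbit_dist a S y z)%N.
Proof.
move=> aM /orbit_dist_ex[g <- <-] /orbit_dist_ex[h <- <-].
rewrite addnC; apply: leq_trans (word_lengthM h g).
by apply: orbit_dist_le; rewrite aM.
Qed.

End OrbitDist.
End WordLength.

(** The constant dominates the length of the image of every generator; the successor keeps it
    positive, as it will scale the constant of integrability. *)
Lemma word_length_morph (G H : groupType) (S : seq G) (T : seq H) (f : G -> H) :
  symmetric_generating S -> symmetric_generating T ->
  f 1%g = 1%g -> (forall x y, f (x * y)%g = (f x * f y)%g) ->
  exists2 C, (0 < C)%N & forall g, (word_length T (f g) <= C * word_length S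
    g)%N.
Proof.
move=> genS genT f1 fM; exists (\sum_(s <- S) word_length T (f s)).+1 => // g.
have [w [wS <-] <-] := word_length_word genS g.
elim: w wS => [|s w IH] wS; first by rewrite big_nil f1 word_length1.
rewrite big_cons fM mulnS; apply: leq_trans (word_lengthM genT _ _) _.
apply: leq_add; last by apply: IH => t tw; apply: wS; rewrite inE tw orbT.
apply: leqW; have sS : s \in S by apply: wS; rewrite inE eqxx.
by rewrite (big_rem s) //= leq_addr.
Qed.

Definition lamp_incl (L G : groupType) (x : G) (l : L) : wreath L G :=
  (lamp x l, 1%g).
Definition base_incl (L G : groupType) (g : G) : wreath L G := (lamps1 L G, g).

Section WreathGenerators.
Variables L G : groupType.

Let wreathE := (lampsME, lamps_actE, lampE, lamps1E).

Lemma lamp_incl1 x : lamp_incl x 1%g = 1%g :> wreath L G.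
Proof. by congr pair; apply/fsfunP => y; rewrite !wreathE if_same. Qed.

Lemma lamp_inclM x l m :
  lamp_incl x (l * m)%g = (lamp_incl x l * lamp_incl x m)%g :> wreath L G.
Proof.
congr pair => /=; last by rewrite mul1g.
apply/fsfunP => y; rewrite !wreathE invg1 mul1g.
by case: ifP; rewrite ?mul1g.
Qed.

Lemma base_inclM g h :
  base_incl L (g * h)%g = (base_incl L g * base_incl L h)%g :> wreath L G.
Proof. by congr pair; apply/fsfunP => y; rewrite !wreathE mul1g. Qed.

Lemma lamp_incl_conj x l : lamp_incl x l =
  (base_incl L x * (lamp_incl 1%g l * base_incl L x^-1))%g :> wreath L G.
Proof.
congr pair => /=; last by rewrite mul1g mulgV.
apply/fsfunP => y; rewrite !wreathE.
by rewrite mul1g mulg1 -[in RHS](inj_eq (mulgI x)) mulVKg mulg1.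
Qed.

(** Induction on a list containing the support: one lamp is split off at a time, and a lamp at [x]
    is a base conjugate of a lamp at the identity. *)
Lemma wreath_ind (P : wreath L G -> Prop) :
  (forall g, P (base_incl L g)) -> (forall l, P (lamp_incl 1%g l)) ->
  (forall u v, P u -> P v -> P (u * v)%g) -> forall u, P u.
Proof.
move=> Pbase Plamp PM [f g].
have -> : ((f, g) : wreath L G) = (((f, 1%g) : wreath L G) * base_incl L g)%g.
  congr pair => /=; last by rewrite mul1g.
  by apply/fsfunP => y; rewrite !wreathE mulg1.
apply: (PM) (Pbase g).
suff H (s : seq G) (h : lamps L G) : {subset finsupp h <= s} ->
    P ((h, 1%g) : wreath L G) by exact: (H (finsupp f)).
elim: s h => [|x s IH] h hs.
  rewrite (_ : (_, _) = base_incl L 1%g) //; congr pair; apply/fsfunP => y.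
  by rewrite lamps1E fsfun_dflt //; apply/negP => /hs.
pose h' : lamps L G := [fsfun y in finsupp h => if y == x then 1%g else h y].
have h'E y : h' y = if y == x then 1%g else h y.
  by rewrite /h' fsfunE; case: finsuppP => //; rewrite if_same.
have -> : ((h, 1%g) : wreath L G) =
    (lamp_incl x (h x) * ((h', 1%g) : wreath L G))%g.
  congr pair => /=; last by rewrite mul1g.
  apply/fsfunP => y; rewrite !wreathE h'E invg1 mul1g.
  by case: eqP => [->|_]; rewrite ?mulg1 ?mul1g.
apply: (PM).
  by rewrite lamp_incl_conj; apply: (PM) => //; apply: (PM).
apply: IH => y; rewrite mem_finsupp h'E.
case: (y =P x) => [_ /eqP|/eqP yx hy] //.
have : y \in x :: s by apply: hs; rewrite mem_finsupp.
by rewrite inE (negbTE yx).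
Qed.

End WreathGenerators.

(** * Displacements *)

(** The distance is [n] when some element of length [n] ([E1]) but no shorter one ([E2]) realises
    [h z]. The set [E3] accounts for the default value 0 off the orbit. *)
Lemma measurable_orbit_dist (R : realType) d (Z : measurableType d)
    (V : groupType) (T : seq V) (B : V -> Z -> Z) (h : Z -> Z) :
  standard_borel R Z -> countable [set: V] ->
  (forall v, measurable_fun setT (B v)) -> measurable_fun setT h ->
  forall n, measurable ((fun z => orbit_dist B T z (h z)) @^-1` [set n]).
Proof.
move=> sbZ cV mB mh n.
pose E v := [set z | B v z = h z].
have mE v : measurable (E v) by exact: (measurable_eq_fun sbZ (mB v) mh).
pose E1 := \bigcup_v (if word_length T v == n then E v else set0).
pose E2 := \bigcap_v (if (n <= word_length T v)%N then setT else ~` E v).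
pose E3 := if n == 0%N then \bigcap_v ~` E v else set0.
rewrite (_ : _ @^-1` _ = (E1 `&` E2) `|` E3).
  apply: measurableU; first apply: measurableI.
  - apply: countable_bigcupT_measurable => // v.
    by case: ifP => _; [exact: mE|exact: measurable0].
  - apply: countable_bigcapT_measurable => // v.
    by case: ifP => _; [exact: measurableT|exact/measurableC/mE].
  - rewrite /E3; case: ifP => _; last exact: measurable0.
    by apply: countable_bigcapT_measurable => // v; exact/measurableC/mE.
apply/seteqP; split=> z /=.
  have [[v Ev]|nE] := pselect (exists v, E v z).
    move=> dz; left; have [w Ew wE] := @orbit_dist_ex _ T _ B _ _ (ex_intro _
      v Ev).
    split; first by exists w => //; rewrite wE dz eqxx.
    move=> u _; case: ifPn => // /negP nle Eu; apply: nle.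
    by rewrite -dz; exact: orbit_dist_le.
  have -> : orbit_dist B T z (h z) = 0%N.
    rewrite /orbit_dist (_ : [set _ | _ in _] = set0) ?least_set0 //.
    by apply/seteqP; split=> // k [v Ev ?]; case: nE; exists v.
  move=> dz; right; rewrite /E3 -dz eqxx => v _ Ev; apply: nE; by exists v.
case=> [[[v _] vn le_n]|].
  move: vn; case: eqP => // vn Ev.
  apply/eqP; rewrite eqn_leq -{1}vn orbit_dist_le //=.
  have [w Ew <-] := @orbit_dist_ex _ T _ B _ _ (ex_intro _ v Ev).
  by have := le_n w Logic.I; case: ifP => // _ /(_ Ew).
rewrite /E3; case: eqP => // -> nE.
rewrite /orbit_dist (_ : [set _ | _ in _] = set0) ?least_set0 //.
by apply/seteqP; split=> // k [v Ev ?]; case: (nE v).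
Qed.

Section Displacement.
Variables (R : realType) (phi : R -> R).
Hypothesis phi_ge0 : forall x, 0 <= x -> 0 <= phi x.
Hypothesis phi_nd : forall x y, 0 <= x -> x <= y -> phi x <= phi y.

(** The cost is constant on each of the countably many level sets of [f]. *)
Lemma measurable_cost d (Z : measurableType d) (f : Z -> nat) (c : R) :
  (forall n, measurable (f @^-1` [set n])) ->
  measurable_fun [set: Z] (fun z => (phi ((f z)%:R / c))%:E).
Proof.
move=> mf.
apply: (@measurable_fun_countable _ _ _ _ nat f (fun n _ =>
  (phi (n%:R / c))%:E)) => //.
Qed.

Lemma cost_ge0 (c : R) n : 0 < c -> (0 <= (phi (n%:R / c))%:E)%E.
Proof. by move=> c0; rewrite lee_fin phi_ge0 // divr_ge0 // ltW. Qed.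

Lemma cost_scale (f g C : nat) (c : R) :
  0 < c -> (0 < C)%N -> (f <= C * g)%N ->
  phi (f%:R / (C%:R * c)) <= phi (g%:R / c).
Proof.
move=> c0 C0 fCg; have C0' : 0 < C%:R :> R by rewrite ltr0n.
apply: phi_nd; first by rewrite divr_ge0 // mulr_ge0 // ltW.
by rewrite invfM mulrA ler_pM2r ?invr_gt0 // ler_pdivrMr // mulrC -natrM
  ler_nat.
Qed.

(** Since [f] is at most twice the larger of [g] and [h], monotonicity bounds the left side by the
    cost of that one alone; the other cost is nonnegative. *)
Lemma cost_add (f g h : nat) (c c' : R) :
  0 < c -> 0 < c' -> (f <= g + h)%N ->
  phi (f%:R / (2 * Num.max c c')) <= phi (g%:R / c) + phi (h%:R / c').
Proof.
move=> c0 c'0 fgh; set C := Num.max c c'.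
have C0 : 0 < C by rewrite lt_max c0.
have le_cost (k : nat) (e : R) : 0 < e -> e <= C -> (f <= 2 * k)%N ->
    phi (f%:R / (2 * C)) <= phi (k%:R / e).
  move=> e0 eC fk; apply: (@le_trans _ _ (phi (k%:R / C)));
    first exact: cost_scale.
  apply: phi_nd; first by rewrite divr_ge0 // ltW.
  by rewrite ler_wpM2l // lef_pV2 ?posrE.
have cC : c <= C by rewrite le_max lexx.
have c'C : c' <= C by rewrite le_max lexx orbT.
have pg : 0 <= phi (g%:R / c) by rewrite phi_ge0 // divr_ge0 // ltW.
have ph : 0 <= phi (h%:R / c') by rewrite phi_ge0 // divr_ge0 // ltW.
have [gh|hg] := leqP g h.
  apply: ler_wpDl => //; apply: le_cost => //.
  by rewrite (leq_trans fgh) // mul2n -addnn leq_add2r.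
apply: ler_wpDr => //; apply: le_cost => //.
by rewrite (leq_trans fgh) // mul2n -addnn leq_add2l ltnW.
Qed.

Context d (Z : measurableType d) (M : probability Z R).
Variables (U V : groupType) (T : seq V).
Variables (A : U -> Z -> Z) (B : V -> Z -> Z).
Hypotheses (genT : symmetric_generating T) (sbZ : standard_borel R Z).
Hypotheses (pA : pmp_action M A) (pB : pmp_action M B).
Hypothesis AB : same_orbits_ae M A B.

(** The body of [integrable_displacement] at a single element, in the form that [wreath_ind]
    needs. *)
Definition finite_displacement (u : U) : Prop :=
  exists2 c : R, 0 < c &
    (\int[M]_z (phi ((orbit_dist B T z (A u z))%:R / c))%:E < +oo)%E.

Let D u z := orbit_dist B T z (A u z).

Let mD u n : measurable (D u @^-1` [set n]).
Proof.
have [_ _ mA _] := pA; have [_ _ mB _] := pB.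
exact: (measurable_orbit_dist T sbZ (countable_generated genT) mB (mA u)).
Qed.

Let preserving_A u : measure_preserving M M (A u).
Proof. by have [_ _ mA PA] := pA; split; [exact: mA|exact: PA]. Qed.

Let orbit_ex z u : range (A ^~ z) = range (B ^~ z) -> exists v, B v z = A u z.
Proof.
move=> ABz; have : range (B ^~ z) (A u z) by rewrite -ABz; exists u.
by move=> [v _ <-]; exists v.
Qed.

Lemma finite_displacementM u v :
  finite_displacement u -> finite_displacement v ->
  finite_displacement (u * v)%g.
Proof.
move=> [c c0 uc] [c' c'0 vc].
have [_ AM _ _] := pA; have [_ BM _ _] := pB.
exists (2 * Num.max c c'); first by rewrite mulr_gt0 // lt_max c0.
have mDA : forall n, measurable ((fun z => D u (A v z)) @^-1` [set n]).
  by move=> n; exact: measurable_preimage (preserving_A v).1 (mD u n).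
apply: (@le_lt_trans _ _ (\int[M]_z ((phi ((D u (A v z))%:R / c))%:E +
    (phi ((D v z)%:R / c'))%:E))%E).
  apply: ae_ge0_le_integral => //.
  - by move=> z _; apply: cost_ge0; rewrite mulr_gt0 // lt_max c0.
  - exact: (measurable_cost _ (mD (u * v)%g)).
  - by move=> z _; rewrite adde_ge0 ?cost_ge0.
  - by apply: emeasurable_funD; apply: measurable_cost.
  (* The triangle inequality passes through [A v z], so the orbits must agree at [A v z] as well as
     at [z]. *)
  have := ae_preserving (preserving_A v) AB.
  apply: filterS2 AB => z ABz ABvz _.
  rewrite -EFinD lee_fin; apply: cost_add => //.
  rewrite /D AM addnC.
  by apply: orbit_dist_triangle => //; apply: orbit_ex.
rewrite ge0_integralD //.
- apply: lte_add_pinfty; last exact: vc.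
  have := ge0_integral_preserving (preserving_A v) (measurable_cost c (mD u))
    (fun z => cost_ge0 _ c0).
  by move=> ->.
- by move=> z _; exact: cost_ge0.
- exact: measurable_cost.
- by move=> z _; exact: cost_ge0.
- exact: measurable_cost.
Qed.

(** A shortest [h] realising the move of [p z] yields [j h], which realises the move of [z] and is
    longer by at most a constant factor. It serves for the base group, with [p] the projection to
    [X], and for lamps at the identity, with [p] the coordinate there. *)
Lemma finite_displacement_transfer d' (X : measurableType d')
    (m : probability X R) (p : Z -> X) (G H : groupType) (S : seq H)
    (a : G -> X -> X) (b : H -> X -> X) (i : G -> U) (j : H -> V) :
  measure_preserving M m p -> symmetric_generating S -> standard_borel R X ->
  pmp_action m a -> pmp_action m b ->
  j 1%g = 1%g -> (forall x y, j (x * y)%g = (j x * j y)%g) ->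
  {ae M, forall z, (forall g, exists h, b h (p z) = a g (p z)) /\
    (forall g h, a g (p z) = b h (p z) -> A (i g) z = B (j h) z)} ->
  integrable_displacement m phi a b S ->
  forall g, finite_displacement (i g).
Proof.
move=> Pp genS sbX [_ _ ma _] [_ _ mb _] j1 jM aeP fin g.
have [c c0 gc] := fin g.
have [C C0 leC] := word_length_morph genS genT j1 jM.
pose h x := orbit_dist b S x (a g x).
have mh n : measurable (h @^-1` [set n]).
  exact: (measurable_orbit_dist S sbX (countable_generated genS) mb (ma g)).
exists (C%:R * c); first by rewrite mulr_gt0 // ltr0n.
apply: le_lt_trans gc.
rewrite -(ge0_integral_preserving Pp (measurable_cost c mh)) //; last first.
  by move=> x; exact: cost_ge0.
apply: ae_ge0_le_integral => //.
- by move=> z _; apply: cost_ge0; rewrite mulr_gt0 // ltr0n.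
- exact: (measurable_cost _ (mD (i g))).
- by move=> z _; exact: cost_ge0.
- exact: measurableT_comp (measurable_cost c mh) Pp.1.
apply: filterS aeP => z [ex_h AB_z] _; rewrite lee_fin; apply: cost_scale => //.
have [k kg kE] := orbit_dist_ex S (ex_h g).
rewrite /h -kE; apply: leq_trans (leC k).
by apply: orbit_dist_le; rewrite (AB_z g k).
Qed.

End Displacement.

(** * Identification of the lamp positions *)

(** The prescribed values are trivial wherever [f] is, so the image of the support of [f] can serve
    as a finite support. *)
Lemma lamps_transport (L L' I J : groupType) (f : lamps L I) (t : I -> J)
    (t' : J -> I) (l : I -> L') :
  cancel t t' -> (forall i, f i = 1%g -> l i = 1%g) ->
  exists f' : lamps L' J, forall i, f' (t i) = l i.
Proof.
move=> tK fl.
exists [fsfun k in [fset t i | i in finsupp f]%fset => l (t' k)] => i.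
rewrite fsfunE tK; case: ifPn => // /negP nti; apply/esym/fl.
by rewrite fsfun_dflt //; apply/negP => fi; apply: nti; apply/imfsetP; exists i.
Qed.

Section GoodSet.
Context (R : realType) d (X : measurableType d) (mu : probability X R).
Context (G H : groupType) (a : G -> X -> X) (b : H -> X -> X).

Record good_set (X0 : set X) : Prop := GoodSet {
  good_measurable : measurable X0;
  good_ae : {ae mu, forall x, X0 x};
  good_free1 : forall x g, X0 x -> a g x = x -> g = 1%g;
  good_free2 : forall x h, X0 x -> b h x = x -> h = 1%g;
  good_orbits : forall x, X0 x -> range (a ^~ x) = range (b ^~ x);
  good_act1 : forall x g, X0 x -> X0 (a g x) }.

(** All translates of the exceptional null set are removed; there are countably many, and what
    remains is invariant. *)
Lemma good_set_exists : countable [set: G] -> oe_coupling mu a b ->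
  exists X0, good_set X0.
Proof.
move=> cG [sbX [pa pb] [fa fb] ab].
have [a1 aM ma Pa] := pa.
have [N [mN N0 goodN]] : {ae mu, forall x, [/\ forall g, a g x = x -> g = 1%g,
    forall h, b h x = x -> h = 1%g & range (a ^~ x) = range (b ^~ x)]}.
  by apply: filterS3 fa fb ab => x.
have goodNC x : ~ N x -> [/\ forall g, a g x = x -> g = 1%g,
    forall h, b h x = x -> h = 1%g & range (a ^~ x) = range (b ^~ x)].
  by move=> nNx; apply: contrapT => bad; apply/nNx/goodN.
have X0N x : (\bigcap_g (a g @^-1` ~` N)) x -> ~ N x.
  by move=> /(_ 1%g Logic.I) /=; rewrite a1.
exists (\bigcap_g (a g @^-1` ~` N)); split.
- apply: countable_bigcapT_measurable => // g.
  by apply: measurable_preimage; [exact: ma|exact: measurableC].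
- apply: filterS (ae_countable (P := fun g x => ~ N (a g x)) cG _) =>
    [x Nx g _|g].
    exact: Nx.
  apply: (@ae_preserving R _ X _ X mu mu (a g) (fun x => ~ N x)).
    by split; [exact: ma|exact: Pa].
  by exists N; split=> // x /= /contrapT.
- by move=> x g /X0N /goodNC[+ _ _]; apply.
- by move=> x h /X0N /goodNC[_ + _]; apply.
- by move=> x /X0N /goodNC[].
- by move=> x g X0x k _ /=; rewrite -aM; exact: X0x.
Qed.

Variable X0 : set X.
Hypotheses (gX0 : good_set X0) (OE : oe_coupling mu a b).

Lemma good_orbit12 x g : X0 x -> exists h, b h x = a g x.
Proof.
move=> X0x; have : range (a ^~ x) (a g x) by exists g.
by rewrite (good_orbits gX0 X0x) => -[h _ hg]; exists h.
Qed.

Lemma good_orbit21 x h : X0 x -> exists g, a g x = b h x.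
Proof.
move=> X0x; have : range (b ^~ x) (b h x) by exists h.
by rewrite -(good_orbits gX0 X0x) => -[g _ gh]; exists g.
Qed.

Lemma good_nonempty : X0 !=set0.
Proof.
apply/set0P/eqP => X00; have [N [mN N0 goodN]] := good_ae gX0.
have : mu setT = 0%E.
  apply: (subset_measure0 (B := N)) => // x _; apply: goodN => /=.
  by rewrite X00.
by rewrite probability_setT => /eqP; rewrite onee_eq0.
Qed.

(* [g^-1 x] and [h^-1 x] are the same point of the common orbit of [x]; this
   is the correspondence between the lamp positions [g] and [h]. *)
Definition same_position (x : X) (g : G) (h : H) : Prop :=
  b h^-1%g x = a g^-1%g x.

Lemma same_positionP x g : X0 x -> exists h, same_position x g h.
Proof.
move=> X0x; have [h hg] := good_orbit12 g^-1%g X0x; exists h^-1%g.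
by rewrite /same_position invgK.
Qed.

Lemma same_positionP' x h : X0 x -> exists g, same_position x g h.
Proof.
move=> X0x; have [g gh] := good_orbit21 h^-1%g X0x; exists g^-1%g.
by rewrite /same_position invgK.
Qed.

Lemma same_position_inj x g h h' : X0 x ->
  same_position x g h -> same_position x g h' -> h = h'.
Proof.
have [_ [_ [b1 bM _ _]] _ _] := OE.
move=> X0x gh gh'; apply/esym/eqP; rewrite -(can_eq (mulgK h^-1%g)) mulgV.
apply/eqP/(good_free2 gX0 X0x).
by rewrite bM gh -gh' -bM mulgV b1.
Qed.

Lemma same_position_inj' x g g' h : X0 x ->
  same_position x g h -> same_position x g' h -> g = g'.
Proof.
have [_ [[a1 aM _ _] _] _ _] := OE.
move=> X0x gh gh'; apply/esym/eqP; rewrite -(can_eq (mulgK g^-1%g)) mulgV.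
apply/eqP/(good_free1 gX0 X0x).
by rewrite aM -gh gh' -aM mulgV a1.
Qed.

Variable x0 : X.
Hypothesis X0x0 : X0 x0.

(* Off the good set the correspondence is copied from [x0]: lamp positions must
   be in bijection at every [x] because actions are required everywhere. *)
Definition retract_good (x : X) : X := if pselect (X0 x) then x else x0.

Let retract_goodP x : X0 (retract_good x).
Proof. by rewrite /retract_good; case: pselect. Qed.

Lemma retract_goodE x : X0 x -> retract_good x = x.
Proof. by rewrite /retract_good; case: pselect. Qed.

Lemma measurable_retract_good : measurable_fun setT retract_good.
Proof.
move=> _ B mB; rewrite setTI.
rewrite (_ : _ @^-1` _ = (X0 `&` B) `|` (~` X0 `&` [set _ | B x0])).
  have mX0 := good_measurable gX0.
  apply: measurableU; apply: measurableI => //; first exact: measurableC.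
  have [Bx0|nBx0] := pselect (B x0).
    by rewrite (_ : [set _ | _] = setT) //; apply/seteqP; split.
  by rewrite (_ : [set _ | _] = set0) //; apply/seteqP; split.
apply/seteqP; split=> x; rewrite /retract_good /=; case: pselect =>
  [X0x|nX0x] /=.
- by left.
- by right.
- by case=> -[].
- by case=> -[].
Qed.

Definition position (x : X) (g : G) : H :=
  xget 1%g [set h | same_position (retract_good x) g h].

Definition position' (x : X) (h : H) : G :=
  xget 1%g [set g | same_position (retract_good x) g h].

Lemma position_same x g : same_position (retract_good x) g (position x g).
Proof.
have [h gh] := same_positionP g (retract_goodP x).
by apply: (@xgetPex _ 1%g [set h | same_position (retract_good x) g h]);
  exists h.
Qed.

Lemma position'_same x h : same_position (retract_good x) (position' x h) h.
Proof.
have [g gh] := same_positionP' h (retract_goodP x).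
by apply: (@xgetPex _ 1%g [set g | same_position (retract_good x) g h]);
  exists g.
Qed.

Lemma positionE x g h :
  position x g = h <-> same_position (retract_good x) g h.
Proof.
split=> [<-|gh]; first exact: position_same.
exact: (same_position_inj (retract_goodP x) (position_same x g) gh).
Qed.

Lemma position'E x g h :
  position' x h = g <-> same_position (retract_good x) g h.
Proof.
split=> [<-|gh]; first exact: position'_same.
exact: (same_position_inj' (retract_goodP x) (position'_same x h) gh).
Qed.

Lemma positionK x : cancel (position x) (position' x).
Proof. by move=> g; apply/position'E; exact: position_same. Qed.

Lemma position'K x : cancel (position' x) (position x).
Proof. by move=> h; apply/positionE; exact: position'_same. Qed.

Let measurable_same_position g h :
  measurable [set x | same_position (retract_good x) g h].
Proof.
have [sbX [[_ _ ma _] [_ _ mb _]] _ _] := OE.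
apply: (measurable_eq_fun sbX).
- exact: measurableT_comp (mb _) measurable_retract_good.
- exact: measurableT_comp (ma _) measurable_retract_good.
Qed.

Lemma measurable_position g h : measurable [set x | position x g = h].
Proof.
rewrite (_ : [set _ | _] = [set x | same_position (retract_good x) g h]) //.
by apply/seteqP; split=> x /=; rewrite positionE.
Qed.

Lemma measurable_position' g h : measurable [set x | position' x h = g].
Proof.
rewrite (_ : [set _ | _] = [set x | same_position (retract_good x) g h]) //.
by apply/seteqP; split=> x /=; rewrite position'E.
Qed.

(** Position [k] over [a g x] and position [g^-1 * k] over [x] denote the same orbit point, and
    likewise for [H]. *)
Lemma position_equivariant x g h k : X0 x -> a g x = b h x ->
  position' x (h^-1 * position (a g x) k)%g = (g^-1 * k)%g.
Proof.
have [_ [[_ aM _ _] [_ bM _ _]] _ _] := OE.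
move=> X0x gh; apply/position'E; rewrite retract_goodE //.
have X0gx : X0 (a g x) by exact: good_act1.
have := position_same (a g x) k; rewrite retract_goodE //.
rewrite /same_position !invgM !invgK bM aM => <-.
by rewrite gh.
Qed.

Lemma position1 x : X0 x -> position x 1%g = 1%g.
Proof.
have [_ [[a1 _ _ _] [b1 _ _ _]] _ _] := OE.
move=> X0x; apply/positionE; rewrite retract_goodE //.
by rewrite /same_position !invg1 a1 b1.
Qed.

End GoodSet.

(** * The coupling of the wreath products *)

Section WreathCoupling.
Context (R : realType) d1 (X : measurableType d1) d2 (Y : measurableType d2).
Context (mu : probability X R) (nu : probability Y R).
Context (G H K L : groupType).
Context (a : G -> X -> X) (b : H -> X -> X) (c : K -> Y -> Y) (e : L -> Y -> Y).
Hypotheses (cG : countable [set: G]) (cH : countable [set: H]).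
Hypotheses (OE1 : oe_coupling mu a b) (OE2 : oe_coupling nu c e).
Variables (X0 : set X) (Y0 : set Y) (x0 : X).
Hypotheses (gX0 : good_set mu a b X0) (gY0 : good_set nu c e Y0) (X0x0 : X0 x0).
Variables (mG : probability (power G Y) R) (mH : probability (power H Y) R).
Hypotheses (PG : is_power_law nu mG) (PH : is_power_law nu mH).

Notation Z := (X * power G Y)%type.
Notation M := (mu \x mG)%E.

Let pos := position a b X0 x0.
Let pos' := position' a b X0 x0.

Definition wreath_action1 : wreath K G -> Z -> Z := wreath_action a c.

(** The outer [relabel] reads the moved base point, so lamps are put back by the bijection at that
    point and not at [z.1]. *)
Definition wreath_action2 (v : wreath L H) (z : Z) : Z :=
  relabel pos (wreath_action b e v (relabel pos' z)).

Lemma wreath_action1_pmp : pmp_action M wreath_action1.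
Proof.
have [_ [pa _] _ _] := OE1; have [_ [pc _] _ _] := OE2.
exact: (wreath_action_pmp pa pc PG).
Qed.

Lemma wreath_action2_pmp : pmp_action M wreath_action2.
Proof.
have [_ [_ pb] _ _] := OE1; have [_ [_ pe] _ _] := OE2.
apply: (@pmp_action_conj _ _ _ Z _ (X * power H Y)%type M (mu \x mH)%E
  (wreath_action b e)).
- move=> [x y]; congr pair; apply/funext => g /=.
  by rewrite /pos /pos' (positionK gX0 OE1 X0x0).
- move=> [x y]; congr pair; apply/funext => h /=.
  by rewrite /pos /pos' (position'K gX0 OE1 X0x0).
- apply: (relabel_preserving mu PG PH) => // [x|h g].
    exact: can_inj (position'K gX0 OE1 X0x0 x).
  exact: (measurable_position' gX0 OE1 X0x0 g h).
- apply: (relabel_preserving mu PH PG) => // [x|g h].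
    exact: can_inj (positionK gX0 OE1 X0x0 x).
  exact: (measurable_position gX0 OE1 X0x0 g h).
- exact: (wreath_action_pmp pb pe PH).
Qed.

Definition good_point (z : Z) : Prop := X0 z.1 /\ forall g, Y0 (z.2 g).

Lemma coord_preserving g : measure_preserving M nu (fun z : Z => z.2 g).
Proof.
have Pg : measure_preserving mG nu (fun y : power G Y => y g).
  split=> [|A mA]; first exact: (@measurable_coord G _ Y g).
  exact: (power_law_coord g PG mA).
exact: (measure_preserving_comp (snd_preserving mu mG) Pg).
Qed.

Lemma ae_good_point : {ae M, forall z, good_point z}.
Proof.
have aeX := ae_preserving (fst_preserving mu mG) (good_ae gX0).
have aeY : {ae M, forall z : Z, forall g, Y0 (z.2 g)}.
  by apply: ae_countable => // g;
    exact: ae_preserving (coord_preserving g) (good_ae gY0).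
by apply: filterS2 aeX aeY => z.
Qed.

Lemma wreath_action2E z f g h : good_point z -> a g z.1 = b h z.1 ->
  wreath_action2 (f, h) z = (a g z.1,
    fun k => e (f (pos (a g z.1) k)) (z.2 (g^-1 * k)%g)).
Proof.
case: z => x y [/= X0x _] gh.
rewrite /wreath_action2 /wreath_action /relabel /= -gh; congr pair.
apply/funext => k; congr (e _ (y _)).
exact: (position_equivariant gX0 OE1 X0x0).
Qed.

(** Base elements are matched through the orbit of [x], then lamps one position at a time through
    the orbits in [Y]. Choosing the trivial element wherever [f] is trivial keeps the support
    finite. *)
Lemma wreath_same_orbits : same_orbits_ae M wreath_action1 wreath_action2.
Proof.
apply: filterS ae_good_point => -[x y] gz; have [/= X0x Y0y] := gz.
have [_ [[a1 _ _ _] [b1 _ _ _]] _ _] := OE1.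
have [_ [[c1 _ _ _] [e1 _ _ _]] _ _] := OE2.
apply/seteqP; split=> _ [[f g] _ <-].
  have [h hg] := good_orbit12 gX0 g X0x.
  have /choice[l lP] : forall k, exists l,
      e l (y (g^-1 * k)%g) = c (f k) (y (g^-1 * k)%g) /\ (f k = 1%g -> l = 1%g).
    move=> k; have [->|nfk] := eqVneq (f k) 1%g; first by exists 1%g;
      rewrite c1 e1.
    have [l lk] := good_orbit12 gY0 (f k) (Y0y (g^-1 * k)%g).
    by exists l; split=> // /eqP; rewrite (negbTE nfk).
  have [f' f'E] := lamps_transport (positionK gX0 OE1 X0x0 (a g x))
    (fun k => (lP k).2).
  exists (f', h) => //; rewrite (wreath_action2E _ gz (esym hg)).
  by congr pair; apply/funext => k /=; rewrite /pos f'E (lP k).1.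
have [h hg] := good_orbit21 gX0 g X0x.
have /choice[l lP] : forall k, exists l,
    c l (y (h^-1 * k)%g) = e (f (pos (a h x) k)) (y (h^-1 * k)%g) /\
    (f (pos (a h x) k) = 1%g -> l = 1%g).
  move=> k; have [->|nfk] := eqVneq (f (pos (a h x) k)) 1%g.
    by exists 1%g; rewrite c1 e1.
  have [l lk] := good_orbit21 gY0 (f (pos (a h x) k)) (Y0y (h^-1 * k)%g).
  by exists l; split=> // /eqP; rewrite (negbTE nfk).
have [|f' f'E] := lamps_transport (f := f) (l := fun k => l (pos' (a h x) k))
    (position'K gX0 OE1 X0x0 (a h x)).
  by move=> k fk; apply: (lP _).2; rewrite /pos (position'K gX0 OE1 X0x0).
exists (f', h) => //; rewrite (wreath_action2E _ gz hg).
congr pair; apply/funext => k /=.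
by rewrite -(positionK gX0 OE1 X0x0 (a h x) k) f'E -(lP _).1 /pos'
  (positionK gX0 OE1 X0x0).
Qed.

Lemma wreath_action1_free : ae_free M wreath_action1.
Proof.
apply: filterS ae_good_point => -[x y] [/= X0x Y0y] [f g] [gx fy].
have g1 := good_free1 gX0 X0x gx; congr pair => //.
apply/fsfunP => k; rewrite lamps1E; apply: (good_free1 gY0 (Y0y k)).
by have := congr1 (fun w : power G Y => w k) fy; rewrite g1 invg1 mul1g.
Qed.

Lemma wreath_action2_free : ae_free M wreath_action2.
Proof.
have [_ [[a1 _ _ _] [b1 _ _ _]] _ _] := OE1.
apply: filterS ae_good_point => -[x y] gz; have [/= X0x Y0y] := gz.
move=> [f h] fhz.
have h1 : h = 1%g by apply: (good_free2 gX0 X0x); exact: (congr1 (fun w : Z =>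
  w.1) fhz).
congr pair => //; apply/fsfunP => k; rewrite lamps1E.
rewrite h1 (@wreath_action2E _ f 1%g 1%g gz) /= ?a1 ?b1 // in fhz.
(* Evaluating at the position matched with [k] makes [f] appear at [k] itself. *)
have := congr1 (fun w : Z => w.2 (pos' x k)) fhz.
rewrite /= invg1 mul1g /pos /pos' (position'K gX0 OE1 X0x0).
by apply: (good_free2 gY0 (Y0y _)).
Qed.

Lemma wreath_oe_coupling : oe_coupling M wreath_action1 wreath_action2.
Proof.
have [sbX _ _ _] := OE1; have [sbY _ _ _] := OE2; split.
- exact: standard_borel_power.
- by split; [exact: wreath_action1_pmp|exact: wreath_action2_pmp].
- by split; [exact: wreath_action1_free|exact: wreath_action2_free].
- exact: wreath_same_orbits.
Qed.

Lemma wreath_action_base z g h : good_point z -> a g z.1 = b h z.1 ->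
  wreath_action1 (base_incl K g) z = wreath_action2 (base_incl L h) z.
Proof.
have [_ [[c1 _ _ _] [e1 _ _ _]] _ _] := OE2.
move=> gz gh; rewrite (wreath_action2E _ gz gh); congr pair.
by apply/funext => k /=; rewrite !lamps1E c1 e1.
Qed.

(** The identity positions correspond, both sitting above the base point, and by injectivity no
    other position is sent to the identity; so both sides change the same lamp. *)
Lemma wreath_action_lamp z k l : good_point z ->
  c k (z.2 1%g) = e l (z.2 1%g) ->
  wreath_action1 (lamp_incl 1%g k) z = wreath_action2 (lamp_incl 1%g l) z.
Proof.
have [_ [[a1 _ _ _] [b1 _ _ _]] _ _] := OE1.
have [_ [[c1 _ _ _] [e1 _ _ _]] _ _] := OE2.
move=> gz kl; have [X0x _] := gz.
rewrite (@wreath_action2E _ _ 1%g 1%g gz) ?a1 ?b1 //.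
rewrite /wreath_action1 /wreath_action /= a1; congr pair; apply/funext => g /=.
rewrite !lampE invg1 mul1g; have [->|g1] := eqVneq g 1%g.
  by rewrite /pos (position1 gX0 OE1 X0x0) // eqxx.
case: eqP => [pg1|_]; last by rewrite c1 e1.
case/eqP: g1; apply: (can_inj (positionK gX0 OE1 X0x0 z.1)).
by rewrite [LHS]pg1 (position1 gX0 OE1 X0x0).
Qed.

End WreathCoupling.

Theorem corollary7p3 (R : realType) (phi psi : R -> R)
  (phi_ge0 : forall x, 0 <= x -> 0 <= phi x)
  (phi_nd : forall x y, 0 <= x -> x <= y -> phi x <= phi y)
  (psi_ge0 : forall x, 0 <= x -> 0 <= psi x)
  (psi_nd : forall x y, 0 <= x -> x <= y -> psi x <= psi y)
  (Gamma1 Gamma2 Lambda1 Lambda2 : groupType)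
  (SGamma1 : seq Gamma1) (SGamma2 : seq Gamma2)
  (SLambda1 : seq Lambda1) (SLambda2 : seq Lambda2)
  (SGamma1_gen : symmetric_generating SGamma1)
  (SGamma2_gen : symmetric_generating SGamma2)
  (SLambda1_gen : symmetric_generating SLambda1)
  (SLambda2_gen : symmetric_generating SLambda2)
  (T1 : seq (wreath Lambda1 Gamma1)) (T2 : seq (wreath Lambda2 Gamma2))
  (T1_gen : symmetric_generating T1) (T2_gen : symmetric_generating T2) :
  has_integrable_oe_coupling phi psi SGamma1 SGamma2 ->
  has_integrable_oe_coupling phi psi SLambda1 SLambda2 ->
  has_integrable_oe_coupling phi psi T1 T2.
Proof.
move=> [d1 [X [mu [a [b [OE1 phi_ab psi_ba]]]]]].
move=> [d2 [Y [nu [c [e [OE2 phi_ce psi_ec]]]]]].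
have cG := countable_generated SGamma1_gen.
have cH := countable_generated SGamma2_gen.
have cK := countable_generated SLambda1_gen.
have [X0 gX0] := good_set_exists cG OE1.
have [Y0 gY0] := good_set_exists cK OE2.
have [x0 X0x0] := good_nonempty gX0.
have [mG PG] := power_law_exists nu cG.
have [mH PH] := power_law_exists nu cH.
have OE := wreath_oe_coupling cG cH OE1 OE2 gX0 gY0 X0x0 PG PH.
have ae_good := ae_good_point cG gX0 gY0 PG.
have P1 := fst_preserving mu mG; have P2 := coord_preserving mu PG 1%g.
have [sbZ [pA pB] _ AB] := OE.
have BA : same_orbits_ae (mu \x mG)%E (wreath_action2 a b e X0 x0)
    (wreath_action1 a c) by apply: filterS AB => z ABz; exact: esym ABz.
have [sbX [pa pb] _ _] := OE1; have [sbY [pc pe] _ _] := OE2.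
eexists; exists (X * power Gamma1 Y)%type, (mu \x mG)%E.
exists (wreath_action1 a c), (wreath_action2 a b e X0 x0); split => //.
(* The base case projects to [X], the lamp case to the coordinate at [1], whose law is [nu]. *)
- apply: wreath_ind => [g|k|u v].
  + apply: (finite_displacement_transfer phi_ge0 phi_nd T2_gen sbZ pA pB P1
      SGamma2_gen sbX pa pb (j := @base_incl Lambda2 Gamma2)) phi_ab g => //.
      exact: base_inclM.
    apply: filterS ae_good => z gz; split=> [g|g h].
      exact: (good_orbit12 gX0 g gz.1).
    exact: (wreath_action_base OE1 OE2 gX0 X0x0 gz).
  + apply: (finite_displacement_transfer phi_ge0 phi_nd T2_gen sbZ pA pB P2
      SLambda2_gen sbY pc pe (j := @lamp_incl Lambda2 Gamma2 1%g)) phi_ce k.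
    * exact: lamp_incl1.
    * exact: lamp_inclM.
    * apply: filterS ae_good => z gz; split=> [k|k l].
        exact: (good_orbit12 gY0 k (gz.2 _)).
      exact: (wreath_action_lamp OE1 OE2 gX0 X0x0 gz).
  + exact: (finite_displacementM phi_ge0 phi_nd T2_gen sbZ pA pB AB).
(* The same three cases with the actions exchanged: orbit witnesses come from [good_orbit21], and
   the agreement of the actions is read backwards. *)
- apply: wreath_ind => [h|l|u v].
  + apply: (finite_displacement_transfer psi_ge0 psi_nd T1_gen sbZ pB pA P1
      SGamma1_gen sbX pb pa (j := @base_incl Lambda1 Gamma1)) psi_ba h => //.
      exact: base_inclM.
    apply: filterS ae_good => z gz; split=> [h|h g /esym gh].
      exact: (good_orbit21 gX0 h gz.1).
    exact/esym/(wreath_action_base OE1 OE2 gX0 X0x0 gz).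
  + apply: (finite_displacement_transfer psi_ge0 psi_nd T1_gen sbZ pB pA P2
      SLambda1_gen sbY pe pc (j := @lamp_incl Lambda1 Gamma1 1%g)) psi_ec l.
    * exact: lamp_incl1.
    * exact: lamp_inclM.
    * apply: filterS ae_good => z gz; split=> [l|l k /esym kl].
        exact: (good_orbit21 gY0 l (gz.2 _)).
      exact/esym/(wreath_action_lamp OE1 OE2 gX0 X0x0 gz).
  + exact: (finite_displacementM psi_ge0 psi_nd T1_gen sbZ pB pA BA).
Qed.
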